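(* Let $k$ be a field of characteristic zero, let $\mathcal{I}$ be the monochromatic graph with two vertices and one edge, with partition $\{1\}\sqcup\{2\}$ of the vertex set, let $B=k e_1\oplus k e_2$, and let $\mathcal{B}(\mathcal{I})$ be its Boalch algebra (presented explicitly in the context). Define a $B$-linear double bracket on $\mathcal{B}(\mathcal{I})$ by \begin{align*} &\{\!\{v_{12},v_{12}\}\!\}=0,\qquad \{\!\{v_{21},v_{21}\}\!\}=0,\\ &\{\!\{v_{21},v_{12}\}\!\}=e_1\otimes e_2+\tfrac12\big(v_{12}v_{21}\otimes e_2+e_1\otimes v_{21}v_{12}\big),\\ &\{\!\{v_{12},v_{21}\}\!\}=-e_2\otimes e_1-\tfrac12\big(e_2\otimes v_{12}v_{21}+v_{21}v_{12}\otimes e_1\big), \end{align*} by using the cyclic antisymmetry and the Leibniz rule. Let $\Phi:=\gamma_1+\gamma_2$. Then the triple $\big(\mathcal{B}(\mathcal{I}),\{\!\{-,-\}\!\},\Phi\big)$ is a Hamiltonian double quasi-Poisson algebra.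
   Context: The algebra $\mathcal{B}(\mathcal{I})$. It is the associative unital $k$-algebra generated by $e_1,e_2,v_{12},v_{21},w_{12},w_{21},\gamma_1^{\pm1},\gamma_2^{\pm1}$ subject to $1=e_1+e_2$, $e_ie_j=\delta_{ij}e_i$, $v_{ij}=e_iv_{ij}e_j$, $w_{ij}=e_iw_{ij}e_j$, $\gamma_i^{\pm1}=e_i\gamma_i^{\pm1}e_i$, $\gamma_i\gamma_i^{-1}=e_i=\gamma_i^{-1}\gamma_i$, and $(1+v_{21})(1+v_{12})=(1+w_{12})(\gamma_1+\gamma_2)(1+w_{21})$. It is generated by $e_1,e_2,v_{12},v_{21}$ and the inverses $\gamma_j^{-1}$, so a $B$-linear double bracket on it is determined by its values on $v_{12},v_{21}$. Double brackets. Write $\otimes=\otimes_k$. Let $I$ be a finite set and let $B=\bigoplus_{s\in I}k e_s$ with orthogonal idempotents $e_s$; let $A$ be an associative unital algebra with a unital morphism $B\to A$, so $1=\sum_s e_s$. A ($B$-linear) double bracket on $A$ is a $k$-bilinear map $\{\!\{-,-\}\!\}:A\times A\to A\otimes A$ that vanishes if an argument lies in (the image of) $B$ and satisfies, for all $a,b,c\in A$, $\{\!\{a,b\}\!\}=-\tau_{(12)}\{\!\{b,a\}\!\}$ (cyclic antisymmetry) and $\{\!\{a,bc\}\!\}=\{\!\{a,b\}\!\}c+b\{\!\{a,c\}\!\}$ (Leibniz rule), where $x(a'\otimes a'')y=xa'\otimes a''y$. Here $\tau_s(a_1\otimes\cdots\otimes a_n)=a_{s^{-1}(1)}\otimes\cdots\otimes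 a_{s^{-1}(n)}$ for a permutation $s$. Put $\{\!\{a,b\otimes c\}\!\}_L=\{\!\{a,b\}\!\}\otimes c$ and $$\{\!\{a,b,c\}\!\}=\{\!\{a,\{\!\{b,c\}\!\}\}\!\}_L+\tau_{(123)}\{\!\{b,\{\!\{c,a\}\!\}\}\!\}_L+\tau_{(132)}\{\!\{c,\{\!\{a,b\}\!\}\}\!\}_L,$$ \begin{align*}\{\!\{a,b,c\}\!\}_{\mathrm{qP}}=\tfrac14\sum_{s\in I}\big(&ce_sa\otimes e_sb\otimes e_s-ce_sa\otimes e_s\otimes be_s-ce_s\otimes ae_sb\otimes e_s+ce_s\otimes ae_s\otimes be_s\\&-e_sa\otimes e_sb\otimes e_sc+e_sa\otimes e_s\otimes be_sc+e_s\otimes ae_sb\otimes e_sc-e_s\otimes ae_s\otimes be_sc\big).\end{align*} The double bracket is quasi-Poisson if $\{\!\{a,b,c\}\!\}=\{\!\{a,b,c\}\!\}_{\mathrm{qP}}$ for all $a,b,c\in A$. A multiplicative moment map is an invertible element $\Phi=\sum_{s\in I}\Phi_s$, $\Phi_s\in e_sAe_s$, with $\{\!\{\Phi_s,a\}\!\}=\frac12(ae_s\otimes\Phi_s-e_s\otimes\Phi_sa+a\Phi_s\otimes e_s-\Phi_s\otimes e_sa)$ for all $a\in A$, $s\in I$. A Hamiltonian double quasi-Poisson algebra is a triple $(A,\{\!\{-,-\}\!\},\Phi)$ with $\{\!\{-,-\}\!\}$ a double quasi-Poisson bracket and $\Phi$ a multiplicative moment map. *)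

(* Defs.v *)
From HB Require Import structures.
From mathcomp Require Import all_boot all_algebra.
From mathcomp Require Import generic_quotient boolp.

Set Implicit Arguments.
Unset Strict Implicit.
Unset Printing Implicit Defensive.

Import GRing.Theory.
Local Open Scope quotient_scope.
Local Open Scope ring_scope.

Reserved Notation "u ⊗ v" (at level 45, left associativity).

(* Associative unital k-algebras given by generators X and relations rel:     *)
(* formal algebra expressions over X, modulo the least congruence containing  *)
(* rel and the axioms of associative unital k-algebras.  The universal        *)
(* property is presented_evalP and presented_eval_uniq below.                 *)

Inductive alg_term (k X : Type) :=
  | AVar of X
  | AZero
  | AOne
  | AAdd of alg_term k X & alg_term k X
  | AScale of k & alg_term k X
  | AMul of alg_term k X & alg_term k X.

Arguments AVar {k X}.
Arguments AZero {k X}.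
Arguments AOne {k X}.

Section Presented.
Variables (k : fieldType) (X : Type).
Variable rel : alg_term k X -> alg_term k X -> Prop.

Local Notation "s ⊕ t" := (AAdd s t) (at level 50).
Local Notation "s ⊙ t" := (AMul s t) (at level 40).
Local Notation "c ∙ t" := (AScale c t) (at level 40).

Inductive alg_cong : alg_term k X -> alg_term k X -> Prop :=
  | ac_rel s t : rel s t -> alg_cong s t
  | ac_refl s : alg_cong s s
  | ac_sym s t : alg_cong s t -> alg_cong t s
  | ac_trans t s u : alg_cong s t -> alg_cong t u -> alg_cong s u
  | ac_add s s' t t' :
      alg_cong s s' -> alg_cong t t' -> alg_cong (s ⊕ t) (s' ⊕ t')
  | ac_scale c s s' : alg_cong s s' -> alg_cong (c ∙ s) (c ∙ s')
  | ac_mul s s' t t' :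
      alg_cong s s' -> alg_cong t t' -> alg_cong (s ⊙ t) (s' ⊙ t')
  | ac_addA s t u : alg_cong (s ⊕ (t ⊕ u)) ((s ⊕ t) ⊕ u)
  | ac_addC s t : alg_cong (s ⊕ t) (t ⊕ s)
  | ac_add0 s : alg_cong (AZero ⊕ s) s
  | ac_addN s : alg_cong ((-1 ∙ s) ⊕ s) AZero
  | ac_scaleA c d s : alg_cong (c ∙ (d ∙ s)) ((c * d) ∙ s)
  | ac_scale1 s : alg_cong (1 ∙ s) s
  | ac_scaleDr c s t : alg_cong (c ∙ (s ⊕ t)) ((c ∙ s) ⊕ (c ∙ t))
  | ac_scaleDl c d s : alg_cong ((c + d) ∙ s) ((c ∙ s) ⊕ (d ∙ s))
  | ac_mulA s t u : alg_cong (s ⊙ (t ⊙ u)) ((s ⊙ t) ⊙ u)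
  | ac_mul1l s : alg_cong (AOne ⊙ s) s
  | ac_mul1r s : alg_cong (s ⊙ AOne) s
  | ac_mulDl s t u : alg_cong ((s ⊕ t) ⊙ u) ((s ⊙ u) ⊕ (t ⊙ u))
  | ac_mulDr s t u : alg_cong (s ⊙ (t ⊕ u)) ((s ⊙ t) ⊕ (s ⊙ u))
  | ac_scaleAl c s t : alg_cong (c ∙ (s ⊙ t)) ((c ∙ s) ⊙ t)
  | ac_scaleAr c s t : alg_cong (c ∙ (s ⊙ t)) (s ⊙ (c ∙ t)).

HB.instance Definition _ := gen_eqMixin (alg_term k X).
HB.instance Definition _ := gen_choiceMixin (alg_term k X).

Definition alg_congb s t := `[< alg_cong s t >].

Lemma alg_congb_equiv : equiv_class_of alg_congb.
Proof.
split=> [s|s t|t s u].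
- exact/asboolP/ac_refl.
- by apply/asboolP/asboolP => /ac_sym.
- by move=> /asboolP st /asboolP tu; apply/asboolP/(ac_trans st).
Qed.

Canonical alg_congb_equivRel := EquivRelPack alg_congb_equiv.

Definition presented := {eq_quot alg_congb}.
HB.instance Definition _ := Choice.on presented.
HB.instance Definition _ := EqQuotient.on presented.

Definition pcls (s : alg_term k X) : presented := \pi s.
Definition pgen (x : X) : presented := pcls (AVar x).

Lemma pclsP s t : alg_cong s t <-> pcls s = pcls t.
Proof.
by split=> [st|/eqmodP/asboolP //]; apply/eqmodP/asboolP.
Qed.

Lemma repr_pcls s : alg_cong (repr (pcls s)) s.
Proof. by apply/pclsP; rewrite /pcls reprK. Qed.

Lemma pclsW (P : presented -> Prop) : (forall s, P (pcls s)) -> forall x, P x.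
Proof. by move=> Ps x; rewrite -[x]reprK; apply: Ps. Qed.

Definition padd (x y : presented) := pcls (repr x ⊕ repr y).
Definition pscale c (x : presented) := pcls (c ∙ repr x).
Definition pmul (x y : presented) := pcls (repr x ⊙ repr y).

Lemma pcls_add s t : padd (pcls s) (pcls t) = pcls (s ⊕ t).
Proof. by apply/pclsP/ac_add; apply: repr_pcls. Qed.
Lemma pcls_scale c s : pscale c (pcls s) = pcls (c ∙ s).
Proof. by apply/pclsP/ac_scale; apply: repr_pcls. Qed.
Lemma pcls_mul s t : pmul (pcls s) (pcls t) = pcls (s ⊙ t).
Proof. by apply/pclsP/ac_mul; apply: repr_pcls. Qed.

Let pE := (pcls_add, pcls_scale, pcls_mul).

Let paddA : associative padd.
Proof.
by do 3![elim/pclsW=> ?]; rewrite !pE; apply/pclsP/ac_addA.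
Qed.
Let paddC : commutative padd.
Proof. by do 2![elim/pclsW=> ?]; rewrite !pE; apply/pclsP/ac_addC. Qed.
Let padd0 : left_id (pcls AZero) padd.
Proof. by elim/pclsW=> ?; rewrite !pE; apply/pclsP/ac_add0. Qed.
Let paddN : left_inverse (pcls AZero) (pscale (-1)) padd.
Proof. by elim/pclsW=> ?; rewrite !pE; apply/pclsP/ac_addN. Qed.

HB.instance Definition _ :=
  GRing.isZmodule.Build presented paddA paddC padd0 paddN.

Let pscaleA c d x : pscale c (pscale d x) = pscale (c * d) x.
Proof. by elim/pclsW: x => ?; rewrite !pE; apply/pclsP/ac_scaleA. Qed.
Let pscale1 : left_id 1 pscale.
Proof. by elim/pclsW=> ?; rewrite !pE; apply/pclsP/ac_scale1. Qed.
Let pscaleDr : right_distributive pscale +%R.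
Proof.
by move=> c; do 2![elim/pclsW=> ?]; rewrite /GRing.add /= !pE;
  apply/pclsP/ac_scaleDr.
Qed.
Let pscaleDl x : {morph pscale^~ x : c d / c + d}.
Proof.
elim/pclsW: x => s c d; rewrite [RHS]/GRing.add /= !pE.
exact/pclsP/ac_scaleDl.
Qed.

HB.instance Definition _ := GRing.Zmodule_isLmodule.Build k presented
  pscaleA pscale1 pscaleDr pscaleDl.

Let pmulA : associative pmul.
Proof. by do 3![elim/pclsW=> ?]; rewrite !pE; apply/pclsP/ac_mulA. Qed.
Let pmul1l : left_id (pcls AOne) pmul.
Proof. by elim/pclsW=> ?; rewrite !pE; apply/pclsP/ac_mul1l. Qed.
Let pmul1r : right_id (pcls AOne) pmul.
Proof. by elim/pclsW=> ?; rewrite !pE; apply/pclsP/ac_mul1r. Qed.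
Let pmulDl : left_distributive pmul +%R.
Proof.
by do 3![elim/pclsW=> ?]; rewrite /GRing.add /= !pE; apply/pclsP/ac_mulDl.
Qed.
Let pmulDr : right_distributive pmul +%R.
Proof.
by do 3![elim/pclsW=> ?]; rewrite /GRing.add /= !pE; apply/pclsP/ac_mulDr.
Qed.

HB.instance Definition _ := GRing.Zmodule_isPzRing.Build presented
  pmulA pmul1l pmul1r pmulDl pmulDr.

Lemma paddE (x y : presented) : x + y = padd x y. Proof. by []. Qed.
Lemma pscaleE c (x : presented) : c *: x = pscale c x. Proof. by []. Qed.
Lemma pmulE (x y : presented) : x * y = pmul x y. Proof. by []. Qed.

Let ppE := (paddE, pscaleE, pmulE, pcls_add, pcls_scale, pcls_mul).

Lemma presented_scaleAl c (x y : presented) : c *: (x * y) = (c *: x) * y.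
Proof.
elim/pclsW: x => s; elim/pclsW: y => t.
by rewrite !ppE; apply/pclsP/ac_scaleAl.
Qed.
Lemma presented_scaleAr c (x y : presented) : c *: (x * y) = x * (c *: y).
Proof.
elim/pclsW: x => s; elim/pclsW: y => t.
by rewrite !ppE; apply/pclsP/ac_scaleAr.
Qed.

Section Eval.
Variables (A : algType k) (f : X -> A).

Fixpoint alg_eval (s : alg_term k X) : A :=
  match s with
  | AVar x => f x
  | AZero => 0
  | AOne => 1
  | AAdd s t => alg_eval s + alg_eval t
  | AScale c s => c *: alg_eval s
  | AMul s t => alg_eval s * alg_eval t
  end.

Definition presented_eval (x : presented) := alg_eval (repr x).

Hypothesis frel : forall s t, rel s t -> alg_eval s = alg_eval t.

Lemma alg_eval_cong s t : alg_cong s t -> alg_eval s = alg_eval t.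
Proof.
elim=> {s t} /=.
- exact: frel.
- by [].
- by move=> s t _ ->.
- by move=> t s u _ -> _ ->.
- by move=> s s' t t' _ -> _ ->.
- by move=> c s s' _ ->.
- by move=> s s' t t' _ -> _ ->.
- by move=> *; rewrite addrA.
- by move=> *; rewrite addrC.
- by move=> *; rewrite add0r.
- by move=> *; rewrite scaleN1r addNr.
- by move=> *; rewrite scalerA.
- by move=> *; rewrite scale1r.
- by move=> *; rewrite scalerDr.
- by move=> *; rewrite scalerDl.
- by move=> *; rewrite mulrA.
- by move=> *; rewrite mul1r.
- by move=> *; rewrite mulr1.
- by move=> *; rewrite mulrDl.
- by move=> *; rewrite mulrDr.
- by move=> *; rewrite scalerAl.
- by move=> *; rewrite scalerAr.
Qed.

Lemma presented_eval_cls s : presented_eval (pcls s) = alg_eval s.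
Proof. exact/alg_eval_cong/repr_pcls. Qed.

Lemma presented_evalP :
  [/\ forall x, presented_eval (pgen x) = f x,
      forall c, {morph presented_eval : x y / c *: x + y},
      presented_eval 1 = 1 & {morph presented_eval : x y / x * y}].
Proof.
split=> [x|c|| ]; try exact: presented_eval_cls.
- move=> x y; elim/pclsW: x => s; elim/pclsW: y => t.
  by rewrite pscaleE pcls_scale paddE pcls_add !presented_eval_cls.
- move=> x y; elim/pclsW: x => s; elim/pclsW: y => t.
  by rewrite pmulE pcls_mul !presented_eval_cls.
Qed.

Lemma presented_eval_uniq (g : presented -> A) :
    (forall x, g (pgen x) = f x) -> (forall c, {morph g : x y / c *: x + y}) ->
    g 1 = 1 -> {morph g : x y / x * y} ->
  g =1 presented_eval.
Proof.
move=> gX gL g1 gM; elim/pclsW=> s; rewrite presented_eval_cls.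
have g0 : g 0 = 0.
  by have := gL (-1) 0 0; rewrite scaler0 addr0 scaleN1r addNr.
elim: s => [x|||s IHs t IHt|c s IHs|s IHs t IHt] /=.
- exact: gX.
- exact: g0.
- exact: g1.
- have -> : pcls (s ⊕ t) = 1 *: pcls s + pcls t.
    by rewrite scale1r paddE pcls_add.
  by rewrite gL IHs IHt scale1r.
- have -> : pcls (c ∙ s) = c *: pcls s + 0.
    by rewrite addr0 pscaleE pcls_scale.
  by rewrite gL IHs g0 addr0.
- have -> : pcls (s ⊙ t) = pcls s * pcls t by rewrite pmulE pcls_mul.
  by rewrite gM IHs IHt.
Qed.

End Eval.
End Presented.

(* The tensor product over k, built as formal expressions modulo the least    *)
(* congruence making it a k-module and the pure tensors bilinear.  The        *)
(* universal property is tliftP and tlift_uniq below.                         *)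

Inductive tensor_term (k U V : Type) :=
  | TPure of U & V
  | TZero
  | TAdd of tensor_term k U V & tensor_term k U V
  | TScale of k & tensor_term k U V.

Arguments TPure {k U V}.
Arguments TZero {k U V}.

Section Tensor.
Variables (k : fieldType) (U V : lmodType k).

Local Notation term := (tensor_term k U V).
Local Notation "s ⊕ t" := (TAdd s t) (at level 50).
Local Notation "c ∙ t" := (TScale c t) (at level 40).

Inductive tensor_cong : term -> term -> Prop :=
  | tc_refl s : tensor_cong s s
  | tc_sym s t : tensor_cong s t -> tensor_cong t s
  | tc_trans t s u : tensor_cong s t -> tensor_cong t u -> tensor_cong s u
  | tc_add s s' t t' :
      tensor_cong s s' -> tensor_cong t t' -> tensor_cong (s ⊕ t) (s' ⊕ t')
  | tc_scale c s s' : tensor_cong s s' -> tensor_cong (c ∙ s) (c ∙ s')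
  | tc_addA s t u : tensor_cong (s ⊕ (t ⊕ u)) ((s ⊕ t) ⊕ u)
  | tc_addC s t : tensor_cong (s ⊕ t) (t ⊕ s)
  | tc_add0 s : tensor_cong (TZero ⊕ s) s
  | tc_addN s : tensor_cong ((-1 ∙ s) ⊕ s) TZero
  | tc_scaleA c d s : tensor_cong (c ∙ (d ∙ s)) ((c * d) ∙ s)
  | tc_scale1 s : tensor_cong (1 ∙ s) s
  | tc_scaleDr c s t : tensor_cong (c ∙ (s ⊕ t)) ((c ∙ s) ⊕ (c ∙ t))
  | tc_scaleDl c d s : tensor_cong ((c + d) ∙ s) ((c ∙ s) ⊕ (d ∙ s))
  | tc_linearl c u u' v :
      tensor_cong (TPure (c *: u + u') v) ((c ∙ TPure u v) ⊕ TPure u' v)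
  | tc_linearr c u v v' :
      tensor_cong (TPure u (c *: v + v')) ((c ∙ TPure u v) ⊕ TPure u v').

HB.instance Definition _ := gen_eqMixin term.
HB.instance Definition _ := gen_choiceMixin term.

Definition tensor_congb (s t : term) := `[< tensor_cong s t >].

Lemma tensor_congb_equiv : equiv_class_of tensor_congb.
Proof.
split=> [s|s t|t s u].
- exact/asboolP/tc_refl.
- by apply/asboolP/asboolP => /tc_sym.
- by move=> /asboolP st /asboolP tu; apply/asboolP/(tc_trans st).
Qed.

Canonical tensor_congb_equivRel := EquivRelPack tensor_congb_equiv.

Definition tensor := {eq_quot tensor_congb}.
HB.instance Definition _ := Choice.on tensor.
HB.instance Definition _ := EqQuotient.on tensor.

Definition tcls (s : term) : tensor := \pi s.
Definition tpure (u : U) (v : V) : tensor := tcls (TPure u v).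

Lemma tclsP s t : tensor_cong s t <-> tcls s = tcls t.
Proof.
by split=> [st|/eqmodP/asboolP //]; apply/eqmodP/asboolP.
Qed.

Lemma repr_tcls s : tensor_cong (repr (tcls s)) s.
Proof. by apply/tclsP; rewrite /tcls reprK. Qed.

Lemma tclsW (P : tensor -> Prop) : (forall s, P (tcls s)) -> forall x, P x.
Proof. by move=> Ps x; rewrite -[x]reprK; apply: Ps. Qed.

Definition tadd (x y : tensor) := tcls (repr x ⊕ repr y).
Definition tscale c (x : tensor) := tcls (c ∙ repr x).

Lemma tcls_add s t : tadd (tcls s) (tcls t) = tcls (s ⊕ t).
Proof. by apply/tclsP/tc_add; apply: repr_tcls. Qed.
Lemma tcls_scale c s : tscale c (tcls s) = tcls (c ∙ s).
Proof. by apply/tclsP/tc_scale; apply: repr_tcls. Qed.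

Let tE := (tcls_add, tcls_scale).

Let taddA : associative tadd.
Proof. by do 3![elim/tclsW=> ?]; rewrite !tE; apply/tclsP/tc_addA. Qed.
Let taddC : commutative tadd.
Proof. by do 2![elim/tclsW=> ?]; rewrite !tE; apply/tclsP/tc_addC. Qed.
Let tadd0 : left_id (tcls TZero) tadd.
Proof. by elim/tclsW=> ?; rewrite !tE; apply/tclsP/tc_add0. Qed.
Let taddN : left_inverse (tcls TZero) (tscale (-1)) tadd.
Proof. by elim/tclsW=> ?; rewrite !tE; apply/tclsP/tc_addN. Qed.

HB.instance Definition _ :=
  GRing.isZmodule.Build tensor taddA taddC tadd0 taddN.

Let tscaleA c d x : tscale c (tscale d x) = tscale (c * d) x.
Proof. by elim/tclsW: x => ?; rewrite !tE; apply/tclsP/tc_scaleA. Qed.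
Let tscale1 : left_id 1 tscale.
Proof. by elim/tclsW=> ?; rewrite !tE; apply/tclsP/tc_scale1. Qed.
Let tscaleDr : right_distributive tscale +%R.
Proof.
by move=> c; do 2![elim/tclsW=> ?]; rewrite /GRing.add /= !tE;
  apply/tclsP/tc_scaleDr.
Qed.
Let tscaleDl x : {morph tscale^~ x : c d / c + d}.
Proof.
elim/tclsW: x => s c d; rewrite [RHS]/GRing.add /= !tE.
exact/tclsP/tc_scaleDl.
Qed.

HB.instance Definition _ := GRing.Zmodule_isLmodule.Build k tensor
  tscaleA tscale1 tscaleDr tscaleDl.

Lemma taddE (x y : tensor) : x + y = tadd x y. Proof. by []. Qed.
Lemma tscaleE c (x : tensor) : c *: x = tscale c x. Proof. by []. Qed.

Lemma tpure_bilinear : bilinear_for *:%R *:%R tpure.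
Proof.
split=> [v c u u'|u c v v'].
  by rewrite /= tscaleE tcls_scale taddE tcls_add; apply/tclsP/tc_linearl.
by rewrite /= tscaleE tcls_scale taddE tcls_add; apply/tclsP/tc_linearr.
Qed.

HB.instance Definition _ :=
  bilinear_isBilinear.Build k U V tensor *:%R *:%R tpure tpure_bilinear.

Lemma tensor_ind (P : tensor -> Prop) :
    (forall u v, P (tpure u v)) -> P 0 ->
    (forall x y, P x -> P y -> P (x + y)) -> (forall c x, P x -> P (c *: x)) ->
  forall x, P x.
Proof.
move=> Pu P0 PD PZ; elim/tclsW; elim=> [u v||s Ps t Pt|c s Ps].
- exact: Pu.
- exact: P0.
- by have := PD _ _ Ps Pt; rewrite taddE tE.
- by have := PZ c _ Ps; rewrite tscaleE tE.
Qed.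

Section Lift.
Variables (W : lmodType k) (f : U -> V -> W).

Fixpoint tensor_eval (s : term) : W :=
  match s with
  | TPure u v => f u v
  | TZero => 0
  | TAdd s t => tensor_eval s + tensor_eval t
  | TScale c s => c *: tensor_eval s
  end.

(* The linear map u ⊗ v |-> f u v; meaningful only for a bilinear f. *)
Definition tlift (x : tensor) : W := tensor_eval (repr x).

Hypothesis fL : bilinear_for *:%R *:%R f.

Lemma tensor_eval_cong s t : tensor_cong s t -> tensor_eval s = tensor_eval t.
Proof.
elim=> {s t} /=.
- by [].
- by move=> s t _ ->.
- by move=> t s u _ -> _ ->.
- by move=> s s' t t' _ -> _ ->.
- by move=> c s s' _ ->.
- by move=> *; rewrite addrA.
- by move=> *; rewrite addrC.
- by move=> *; rewrite add0r.
- by move=> *; rewrite scaleN1r addNr.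
- by move=> *; rewrite scalerA.
- by move=> *; rewrite scale1r.
- by move=> *; rewrite scalerDr.
- by move=> *; rewrite scalerDl.
- by move=> c u u' v; apply: fL.1.
- by move=> c u v v'; apply: fL.2.
Qed.

Lemma tlift_cls s : tlift (tcls s) = tensor_eval s.
Proof. exact/tensor_eval_cong/repr_tcls. Qed.

Lemma tliftP : (forall u v, tlift (tpure u v) = f u v) /\ linear tlift.
Proof.
split=> [u v|c x y]; first exact: tlift_cls.
elim/tclsW: x => s; elim/tclsW: y => t.
by rewrite tscaleE tcls_scale taddE tcls_add !tlift_cls.
Qed.

Lemma tlift_uniq (g : tensor -> W) :
  (forall u v, g (tpure u v) = f u v) -> linear g -> g =1 tlift.
Proof.
have [lP lL] := tliftP => gP gL x.
have D (h : tensor -> W) : linear h -> forall x y, h (x + y) = h x + h y.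
  by move=> hL y z; have := hL 1 y z; rewrite !scale1r.
have Z (h : tensor -> W) : linear h -> h 0 = 0 /\
    forall c x, h (c *: x) = c *: h x.
  move=> hL; have h0 : h 0 = 0.
    by have := hL (-1) 0 0; rewrite scaler0 addr0 scaleN1r addNr.
  by split=> // c y; have := hL c y 0; rewrite h0 !addr0.
elim/tensor_ind: x => [u v||x y xP yP|c x xP].
- by rewrite gP lP.
- by rewrite (Z _ gL).1 (Z _ lL).1.
- by rewrite !D // xP yP.
- by rewrite (Z _ gL).2 // (Z _ lL).2 // xP.
Qed.

End Lift.
End Tensor.

Notation "u ⊗ v" := (tpure u v) : ring_scope.

Section DoubleBrackets.
Variables (k : fieldType) (A : algType k).

Definition tensor2 := tensor A A.
Definition tensor3 := tensor tensor2 A.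
HB.instance Definition _ := GRing.Lmodule.on tensor2.
HB.instance Definition _ := GRing.Lmodule.on tensor3.

(* With tau_s (a_1 ⊗ .. ⊗ a_n) = a_(s^-1 1) ⊗ .. ⊗ a_(s^-1 n), the cycle      *)
(* s = (123) sends 1, 2, 3 to 2, 3, 1, so its inverse sends 1, 2, 3 to        *)
(* 3, 1, 2.                                                                   *)
Definition tau12 : tensor2 -> tensor2 := tlift (fun a b => b ⊗ a).
Definition tau123 : tensor3 -> tensor3 :=
  tlift (fun t a3 => tlift (fun a1 a2 => a3 ⊗ a1 ⊗ a2) t).
Definition tau132 : tensor3 -> tensor3 :=
  tlift (fun t a3 => tlift (fun a1 a2 => a2 ⊗ a3 ⊗ a1) t).

(* x (a' ⊗ a'') y = x a' ⊗ a'' y *)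
Definition outer_act (x : A) (t : tensor2) (y : A) : tensor2 :=
  tlift (fun a' a'' => x * a' ⊗ a'' * y) t.

Variables (I : finType) (e : I -> A).

(* A unital algebra morphism from \bigoplus_s k e_s to A amounts to such a    *)
(* family e, and its image is in_base.                                        *)
Record idempotent_base : Prop := IdempotentBase {
  base_orthogonal : forall s t, e s * e t = if s == t then e s else 0;
  base_unital : 1 = \sum_s e s
}.

Definition in_base (x : A) : Prop := exists c : I -> k, x = \sum_s c s *: e s.

Variable br : A -> A -> tensor2.

Record double_bracket : Prop := DoubleBracket {
  bracket_bilinear : bilinear_for *:%R *:%R br;
  bracket_basel : forall a b, in_base a -> br a b = 0;
  bracket_baser : forall a b, in_base b -> br a b = 0;
  bracket_antisym : forall a b, br a b = - tau12 (br b a);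
  bracket_Leibniz : forall a b c,
    br a (b * c) = outer_act 1 (br a b) c + outer_act b (br a c) 1
}.

Definition bracketL (a : A) : tensor2 -> tensor3 :=
  tlift (fun b c => br a b ⊗ c).

Definition triple_bracket (a b c : A) : tensor3 :=
  bracketL a (br b c) + tau123 (bracketL b (br c a))
  + tau132 (bracketL c (br a b)).

Definition triple_qP (a b c : A) : tensor3 :=
  4^-1 *: \sum_s
    (c * e s * a ⊗ e s * b ⊗ e s - c * e s * a ⊗ e s ⊗ b * e s
     - c * e s ⊗ a * e s * b ⊗ e s + c * e s ⊗ a * e s ⊗ b * e s
     - e s * a ⊗ e s * b ⊗ e s * c + e s * a ⊗ e s ⊗ b * e s * c
     + e s ⊗ a * e s * b ⊗ e s * c - e s ⊗ a * e s ⊗ b * e s * c).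

Definition quasi_Poisson : Prop :=
  forall a b c, triple_bracket a b c = triple_qP a b c.

Definition invertible (x : A) : Prop := exists y, x * y = 1 /\ y * x = 1.

Definition multiplicative_moment_map (Phi : A) : Prop :=
  invertible Phi /\
  exists Phi_ : I -> A,
    [/\ forall s, exists a, Phi_ s = e s * a * e s,
        Phi = \sum_s Phi_ s &
        forall s a, br (Phi_ s) a =
          2^-1 *: (a * e s ⊗ Phi_ s - e s ⊗ Phi_ s * a
                   + a * Phi_ s ⊗ e s - Phi_ s ⊗ e s * a)].

Definition Hamiltonian_double_quasi_Poisson (Phi : A) : Prop :=
  [/\ idempotent_base, double_bracket, quasi_Poisson &
      multiplicative_moment_map Phi].

End DoubleBrackets.

Section TensorMaps.
Variables (k : fieldType) (A : algType k).
Implicit Types a b c x y : A.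

Lemma tau12_pure a b : tau12 (a ⊗ b) = b ⊗ a.
Proof.
apply: (tliftP _).1; split=> [v|u] d a1 a2.
  exact: (tpure_bilinear _ _).2.
exact: (tpure_bilinear _ _).1.
Qed.

Lemma outer_act_pure x a b y : outer_act x (a ⊗ b) y = x * a ⊗ b * y.
Proof.
apply: (tliftP _).1; split=> [v|u] d a1 a2 /=.
  by rewrite mulrDr -scalerAr (tpure_bilinear _ _).1.
by rewrite mulrDl -scalerAl (tpure_bilinear _ _).2.
Qed.

Lemma tlift_param_bilinear (W : lmodType k) (g : A -> A -> A -> W) :
    (forall c, bilinear_for *:%R *:%R (fun a b => g a b c)) -> (forall a b, linear (g a b)) ->
  bilinear_for *:%R *:%R
    (fun (t : tensor2 A) c => tlift (fun a b => g a b c) t).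
Proof.
move=> g12 g3; split=> [c d t t'|t d c c'] /=.
  exact: (tliftP (g12 c)).2.
have [p1 l1] := tliftP (g12 (d *: c + c')).
have gl : linear (fun t : tensor2 A => d *: tlift (fun a b => g a b c) t
                                    + tlift (fun a b => g a b c') t).
  move=> m x y; rewrite (tliftP (g12 c)).2 (tliftP (g12 c')).2 !scalerDr.
  by rewrite !scalerA mulrC addrACA.
apply/esym; apply: (tlift_uniq (g12 _) _ gl) => a b /=.
by rewrite (tliftP (g12 c)).1 (tliftP (g12 c')).1 g3.
Qed.

Lemma tau123_bilinear : bilinear_for *:%R *:%R
  (fun (t : tensor2 A) (a3 : A) => tlift (fun a1 a2 => a3 ⊗ a1 ⊗ a2) t).
Proof.
apply: (@tlift_param_bilinear _ (fun a1 a2 a3 => a3 ⊗ a1 ⊗ a2)).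
  move=> a3; split=> [a2|a1] d x y /=; last exact: (tpure_bilinear _ _).2.
  by rewrite (tpure_bilinear _ _).2 (tpure_bilinear _ _).1.
by move=> a1 a2 d x y; rewrite !(tpure_bilinear _ _).1.
Qed.

Lemma tau132_bilinear : bilinear_for *:%R *:%R
  (fun (t : tensor2 A) (a3 : A) => tlift (fun a1 a2 => a2 ⊗ a3 ⊗ a1) t).
Proof.
apply: (@tlift_param_bilinear _ (fun a1 a2 a3 => a2 ⊗ a3 ⊗ a1)).
  move=> a3; split=> [a2|a1] d x y /=; first exact: (tpure_bilinear _ _).2.
  by rewrite !(tpure_bilinear _ _).1.
by move=> a1 a2 d x y; rewrite (tpure_bilinear _ _).2 (tpure_bilinear _ _).1.
Qed.

Lemma tau123_pure a b c : tau123 (a ⊗ b ⊗ c) = c ⊗ a ⊗ b.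
Proof.
rewrite /tau123 (tliftP tau123_bilinear).1.
apply: (tliftP _).1; split=> [a2|a1] d x y /=; last exact: (tpure_bilinear _ _).2.
by rewrite (tpure_bilinear _ _).2 (tpure_bilinear _ _).1.
Qed.

Lemma tau132_pure a b c : tau132 (a ⊗ b ⊗ c) = b ⊗ c ⊗ a.
Proof.
rewrite /tau132 (tliftP tau132_bilinear).1.
apply: (tliftP _).1; split=> [a2|a1] d x y /=; first exact: (tpure_bilinear _ _).2.
by rewrite !(tpure_bilinear _ _).1.
Qed.

Lemma bracketL_pure (br : A -> A -> tensor2 A) a b c :
  bilinear_for *:%R *:%R br -> bracketL br a (b ⊗ c) = br a b ⊗ c.
Proof.
move=> brL; apply: (tliftP _).1; split=> [v|u] d x y /=.
  by rewrite brL.2 (tpure_bilinear _ _).1.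
exact: (tpure_bilinear _ _).2.
Qed.

End TensorMaps.

(* The Boalch algebra of the graph with vertices 1, 2 and one edge.  The      *)
(* vertex set {1, 2} is 'I_2.  GgammaV i is the generator written             *)
(* gamma_i^{-1}: an inverse of gamma_i in the corner e_i A e_i only.          *)

Definition vtx1 : 'I_2 := ord0.
Definition vtx2 : 'I_2 := ord_max.

Inductive boalch_gen :=
  | Ge of 'I_2
  | Gv12 | Gv21
  | Gw12 | Gw21
  | Ggamma of 'I_2
  | GgammaV of 'I_2.

Section Boalch.
Variable k : fieldType.

Local Notation term := (alg_term k boalch_gen).
Local Notation "s ⊕ t" := (AAdd s t) (at level 50).
Local Notation "s ⊙ t" := (AMul s t) (at level 40).
Local Notation "'e[ i ]" := (AVar (Ge i)) (format "''e[' i ]").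
Local Notation "'γ[ i ]" := (AVar (Ggamma i)) (format "''γ[' i ]").
Local Notation "'γV[ i ]" := (AVar (GgammaV i)) (format "''γV[' i ]").
Local Notation v12 := (AVar Gv12).
Local Notation v21 := (AVar Gv21).
Local Notation w12 := (AVar Gw12).
Local Notation w21 := (AVar Gw21).

Inductive boalch_rel : term -> term -> Prop :=
  | br_unit : boalch_rel AOne ('e[vtx1] ⊕ 'e[vtx2])
  | br_idem i j :
      boalch_rel ('e[i] ⊙ 'e[j]) (if i == j then 'e[i] else AZero)
  | br_v12 : boalch_rel v12 ('e[vtx1] ⊙ v12 ⊙ 'e[vtx2])
  | br_v21 : boalch_rel v21 ('e[vtx2] ⊙ v21 ⊙ 'e[vtx1])
  | br_w12 : boalch_rel w12 ('e[vtx1] ⊙ w12 ⊙ 'e[vtx2])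
  | br_w21 : boalch_rel w21 ('e[vtx2] ⊙ w21 ⊙ 'e[vtx1])
  | br_gamma i : boalch_rel 'γ[i] ('e[i] ⊙ 'γ[i] ⊙ 'e[i])
  | br_gammaV i : boalch_rel 'γV[i] ('e[i] ⊙ 'γV[i] ⊙ 'e[i])
  | br_gammaK i : boalch_rel ('γ[i] ⊙ 'γV[i]) 'e[i]
  | br_gammaVK i : boalch_rel ('γV[i] ⊙ 'γ[i]) 'e[i]
  | br_main : boalch_rel
      ((AOne ⊕ v21) ⊙ (AOne ⊕ v12))
      ((AOne ⊕ w12) ⊙ ('γ[vtx1] ⊕ 'γ[vtx2]) ⊙ (AOne ⊕ w21)).

Definition boalch := presented boalch_rel.

HB.instance Definition _ := GRing.PzRing.on boalch.
HB.instance Definition _ := GRing.Lmodule.on boalch.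

Lemma boalch_oner_neq0 : (1 : boalch) != 0.
Proof.
pose f (g : boalch_gen) : k^o := match g with
  | Ge i | Ggamma i | GgammaV i => (i == vtx1)%:R
  | _ => 0 end.
have frel s t : boalch_rel s t -> alg_eval f s = alg_eval f t.
  have bb (b : bool) : b%:R * b%:R = b%:R :> k^o.
    by case: b; rewrite ?mulr1 ?mulr0.
  case=> {s t} /= [|i j|||||i|i|i|i|]; rewrite ?mulr0 ?mul0r ?addr0 ?mulr1 ?bb //.
  have [->|] := eqVneq i j; first by rewrite /= bb.
  have [->|_ _] /= := eqVneq i vtx1; last by rewrite mul0r.
  by rewrite eq_sym => /negPf->; rewrite mulr0.
have [_ fL f1 _] := presented_evalP frel.
apply/eqP => E; move: (fL (-1) 0 0); rewrite -/boalch.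
rewrite scaler0 addr0 scaleN1r addNr -E f1 => /eqP.
by rewrite oner_eq0.
Qed.

HB.instance Definition _ :=
  GRing.PzSemiRing_isNonZero.Build boalch boalch_oner_neq0.
HB.instance Definition _ :=
  GRing.Lmodule_isLalgebra.Build k boalch (@presented_scaleAl _ _ boalch_rel).
HB.instance Definition _ :=
  GRing.Lalgebra_isAlgebra.Build k boalch (@presented_scaleAr _ _ boalch_rel).

Definition boalch_e (i : 'I_2) : boalch := pgen boalch_rel (Ge i).
Definition boalch_v12 : boalch := pgen boalch_rel Gv12.
Definition boalch_v21 : boalch := pgen boalch_rel Gv21.
Definition boalch_gamma (i : 'I_2) : boalch := pgen boalch_rel (Ggamma i).

Definition boalch_Phi : boalch := boalch_gamma vtx1 + boalch_gamma vtx2.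

Record boalch_bracket_values (br : boalch -> boalch -> tensor2 boalch) : Prop :=
  BoalchBracketValues {
    bracket_v12_v12 : br boalch_v12 boalch_v12 = 0;
    bracket_v21_v21 : br boalch_v21 boalch_v21 = 0;
    bracket_v21_v12 : br boalch_v21 boalch_v12 =
      boalch_e vtx1 ⊗ boalch_e vtx2
      + 2^-1 *: (boalch_v12 * boalch_v21 ⊗ boalch_e vtx2
                 + boalch_e vtx1 ⊗ boalch_v21 * boalch_v12);
    bracket_v12_v21 : br boalch_v12 boalch_v21 =
      - (boalch_e vtx2 ⊗ boalch_e vtx1)
      - 2^-1 *: (boalch_e vtx2 ⊗ boalch_v12 * boalch_v21
                 + boalch_v21 * boalch_v12 ⊗ boalch_e vtx1)
  }.

End Boalch.

(* Main.v *)
Require Import Defs.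
From HB Require Import structures.
From mathcomp Require Import all_boot all_algebra.
From mathcomp Require Import boolp ring.

Set Implicit Arguments.
Unset Strict Implicit.
Unset Printing Implicit Defensive.

Import GRing.Theory.
Local Open Scope ring_scope.

(** Write a and b for v_12 and v_21.  Cutting the defining relation
    (1 + b)(1 + a) = (1 + w_12)(gamma_1 + gamma_2)(1 + w_21) with the
    idempotents gives gamma_2 = e_2 + ba, w_12 = a gamma_2^-1,
    w_21 = gamma_2^-1 b and gamma_1 = e_1 - a gamma_2^-1 b, and the last
    element is the inverse of e_1 + ab.  So the algebra is the path algebra of
    two opposite arrows a, b with e_2 + ba inverted in its corner.  For
    derivations into a bimodule M this has two consequences.  A derivation
    that vanishes on the idempotents is determined by its values at a and b,
    because its value at an element determines its value at the inverse
    ([derivation_ext]).  And these values may be prescribed arbitrarily in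
    e_1 M e_2 and e_2 M e_1, because a derivation is a section of the
    square-zero extension by M and the defining relation can be solved there
    ([square_zero_datum], [base_derivation_exists]).

    The bracket is built from such derivations.  The maps {{a,-}} and {{b,-}}
    are the derivations with the prescribed values, and {{c,-}} is the
    derivation whose values at a and b are those imposed by antisymmetry.
    Each axiom of a double bracket then equates two derivations, hence needs
    a check at a and b only; uniqueness follows in the same way
    ([double_bracket_ext]).

    For any double bracket the triple bracket is invariant under cyclic
    permutations and is a derivation in its last argument
    ([triple_bracket_derivation]); the quasi-Poisson expression has the same
    two properties, being an inner derivation in its last argument
    ([triple_qP_inner]).  So the quasi-Poisson identity holds as soon as it
    holds for the triples (a,a,a), (a,a,b), (a,b,b) and (b,b,b)
    ([cyclic_derivation_ext]), where both sides are computed.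

    The two sides of the moment map condition for Phi_s are derivations too.
    For gamma_2 = e_2 + ba they agree at a and b.  For
    gamma_1^-1 = e_1 + ab they agree up to sign, and passing to the inverse
    reverses that sign ([moment_inverse]). *)

(** * Linear maps on tensor products *)

Section LinearFacts.
Variables (k : fieldType) (U V : lmodType k) (f : U -> V).
Hypothesis fL : linear f.

Lemma linear_add x y : f (x + y) = f x + f y.
Proof. by have := fL 1 x y; rewrite !scale1r. Qed.

Lemma linear_zero : f 0 = 0.
Proof. by apply: (addrI (f 0)); rewrite -linear_add !addr0. Qed.

Lemma linear_scale c x : f (c *: x) = c *: f x.
Proof. by have := fL c x 0; rewrite linear_zero !addr0. Qed.

Lemma linear_opp x : f (- x) = - f x.
Proof. by rewrite -scaleN1r linear_scale scaleN1r. Qed.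

End LinearFacts.

Section TensorLinear.
Variable k : fieldType.
Implicit Types U V W : lmodType k.

Lemma tpureDl U V (u u' : U) (v : V) : (u + u') ⊗ v = u ⊗ v + u' ⊗ v.
Proof. exact: (linear_add ((tpure_bilinear U V).1 v)). Qed.
Lemma tpureDr U V (u : U) (v v' : V) : u ⊗ (v + v') = u ⊗ v + u ⊗ v'.
Proof. exact: (linear_add ((tpure_bilinear U V).2 u)). Qed.
Lemma tpureZl U V c (u : U) (v : V) : (c *: u) ⊗ v = c *: (u ⊗ v).
Proof. exact: (linear_scale ((tpure_bilinear U V).1 v)). Qed.
Lemma tpureZr U V c (u : U) (v : V) : u ⊗ (c *: v) = c *: (u ⊗ v).
Proof. exact: (linear_scale ((tpure_bilinear U V).2 u)). Qed.
Lemma tpureNl U V (u : U) (v : V) : (- u) ⊗ v = - (u ⊗ v).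
Proof. exact: (linear_opp ((tpure_bilinear U V).1 v)). Qed.
Lemma tpureNr U V (u : U) (v : V) : u ⊗ (- v) = - (u ⊗ v).
Proof. exact: (linear_opp ((tpure_bilinear U V).2 u)). Qed.
Lemma tpure0l U V (v : V) : (0 : U) ⊗ v = 0.
Proof. exact: (linear_zero ((tpure_bilinear U V).1 v)). Qed.
Lemma tpure0r U V (u : U) : u ⊗ (0 : V) = 0.
Proof. exact: (linear_zero ((tpure_bilinear U V).2 u)). Qed.

Lemma tensor_ext U V W (f g : tensor U V -> W) : linear f -> linear g ->
  (forall u v, f (u ⊗ v) = g (u ⊗ v)) -> f =1 g.
Proof.
move=> fL gL fg; elim/tensor_ind=> [//||x y fgx fgy|c x fgx].
- by rewrite !linear_zero.
- by rewrite !linear_add // fgx fgy.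
- by rewrite !linear_scale // fgx.
Qed.

Lemma tensor3_ext U V W W' (f g : tensor (tensor U V) W -> W') :
  linear f -> linear g ->
  (forall u v w, f (u ⊗ v ⊗ w) = g (u ⊗ v ⊗ w)) -> f =1 g.
Proof.
move=> fL gL fg; apply: (tensor_ext fL gL) => t w.
apply: (@tensor_ext U V _ (fun t => f (t ⊗ w)) (fun t => g (t ⊗ w))) => //.
- by move=> c x y; rewrite tpureDl tpureZl fL.
- by move=> c x y; rewrite tpureDl tpureZl gL.
Qed.

Section Map.
Variables (U V U' V' : lmodType k) (f : U -> U') (g : V -> V').

Definition tmap : tensor U V -> tensor U' V' := tlift (fun u v => f u ⊗ g v).

Hypotheses (fL : linear f) (gL : linear g).

Let tmap_bilinear : bilinear_for *:%R *:%R (fun u v => f u ⊗ g v).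
Proof.
by split=> [v|u] c x y; rewrite ?fL ?gL (tpureDl, tpureDr) (tpureZl, tpureZr).
Qed.

Lemma tmap_pure u v : tmap (u ⊗ v) = f u ⊗ g v.
Proof. exact: (tliftP tmap_bilinear).1. Qed.

Lemma tmap_linear : linear tmap.
Proof. exact: (tliftP tmap_bilinear).2. Qed.

End Map.
End TensorLinear.

Definition tpureE := (tpureDl, tpureDr, tpureZl, tpureZr, tpureNl, tpureNr,
  tpure0l, tpure0r).

(** * Bimodule structures and derivations *)

Section Actions.
Variables (k : fieldType) (A : algType k).

Section Bimodule.
Variable M : lmodType k.

(** Both sides act through one operation, act x m y standing for xmy, as the
    outer structure on a tensor square does. *)
Record bimodule_action (act : A -> M -> A -> M) : Prop := BimoduleAction {
  act_linear : forall x y, linear (act x ^~ y);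
  act_linearl : forall m y, linear (fun x => act x m y);
  act_linearr : forall x m, linear (act x m);
  actA : forall x x' m y' y, act x (act x' m y') y = act (x * x') m (y' * y);
  act1 : forall m, act 1 m 1 = m
}.

Section Derivation.
Variable act : A -> M -> A -> M.

Record derivation (D : A -> M) : Prop := Derivation {
  der_linear : linear D;
  der_mul : forall a b, D (a * b) = act 1 (D a) b + act a (D b) 1
}.

Hypothesis actP : bimodule_action act.

Lemma act0 x y : act x 0 y = 0.
Proof. exact: (linear_zero (act_linear actP x y)). Qed.
Lemma actD x m m' y : act x (m + m') y = act x m y + act x m' y.
Proof. exact: (linear_add (act_linear actP x y)). Qed.
Lemma actZ x c m y : act x (c *: m) y = c *: act x m y.
Proof. exact: (linear_scale (act_linear actP x y)). Qed.
Lemma actN x m y : act x (- m) y = - act x m y.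
Proof. exact: (linear_opp (act_linear actP x y)). Qed.

Lemma derivation_scale_add c D D' : derivation D -> derivation D' ->
  derivation (fun a => c *: D a + D' a).
Proof.
move=> [DL DM] [D'L D'M]; split=> [d x y|x y].
  by rewrite DL D'L !scalerDr !scalerA mulrC addrACA.
by rewrite DM D'M !(actD, actZ) scalerDr addrACA.
Qed.

Lemma inner_derivation m : derivation (fun a => act a m 1 - act 1 m a).
Proof.
split=> [c x y|x y].
  rewrite (act_linearl actP) (act_linearr actP) opprD addrACA scalerDr.
  by rewrite scalerN.
by rewrite !(actD, actN) !(actA actP) !mul1r !mulr1 [RHS]addrC addrA subrK.
Qed.

End Derivation.
End Bimodule.

(** Turns a rule for a product of two generators into a rule that applies
    inside right-associated words. *)
Lemma mul_tail (x y z : A) : x * y = z -> forall t, x * (y * t) = z * t.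
Proof. by move=> <- t; rewrite mulrA. Qed.

Section Corners.
Variables (I : finType) (E : I -> A).

Lemma corner_mull (eP : idempotent_base E) i i' j x : x = E i * x * E j ->
  E i' * x = if i' == i then x else 0.
Proof.
move=> ->; rewrite !mulrA (base_orthogonal eP).
by case: eqP => [->|_]; rewrite ?mul0r.
Qed.

Lemma corner_mulr (eP : idempotent_base E) i j j' x : x = E i * x * E j ->
  x * E j' = if j == j' then x else 0.
Proof.
move=> ->; rewrite -!mulrA (base_orthogonal eP).
by case: eqP => [->|_]; rewrite ?mulr0.
Qed.

Lemma corner_mul0 (eP : idempotent_base E) i j i' j' x y :
  x = E i * x * E j -> y = E i' * y * E j' -> j != i' -> x * y = 0.
Proof.
move=> -> -> ji'; rewrite -!mulrA (mulrA (E j)) (base_orthogonal eP).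
by rewrite (negPf ji') !(mul0r, mulr0).
Qed.

End Corners.

Lemma tau12_linear : linear (@tau12 k A).
Proof.
have H : bilinear_for *:%R *:%R (fun a b : A => b ⊗ a).
  by split=> [v|u] c x y; rewrite !tpureE.
exact: (tliftP H).2.
Qed.
HB.instance Definition _ :=
  GRing.isLinear.Build k (tensor2 A) (tensor2 A) *:%R (@tau12 k A) tau12_linear.

Lemma tau123_linear : linear (@tau123 k A).
Proof. exact: (tliftP (tau123_bilinear A)).2. Qed.
HB.instance Definition _ :=
  GRing.isLinear.Build k (tensor3 A) (tensor3 A) *:%R (@tau123 k A)
    tau123_linear.

Lemma tau132_linear : linear (@tau132 k A).
Proof. exact: (tliftP (tau132_bilinear A)).2. Qed.
HB.instance Definition _ :=
  GRing.isLinear.Build k (tensor3 A) (tensor3 A) *:%R (@tau132 k A)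
    tau132_linear.

Lemma tau12K : involutive (@tau12 k A).
Proof.
apply: (@tensor_ext _ A A (tensor2 A)) => [c x y|//|u v].
  by rewrite !linearP.
by rewrite !tau12_pure.
Qed.

Lemma tau123_tau123 t : tau123 (tau123 t) = tau132 t :> tensor3 A.
Proof.
apply: (@tensor3_ext _ A A A (tensor3 A) (fun t => tau123 (tau123 t))
  (@tau132 k A)) t => [c x y|c x y|u v w]; try by rewrite !linearP.
by rewrite !tau123_pure tau132_pure.
Qed.

Lemma tau123_tau132 t : tau123 (tau132 t) = t :> tensor3 A.
Proof.
apply: (@tensor3_ext _ A A A (tensor3 A) (fun t => tau123 (tau132 t)) id)
  t => [c x y|//|u v w].
  by rewrite !linearP.
by rewrite tau132_pure tau123_pure.
Qed.

Lemma mulr_linear (x : A) : linear (fun a => x * a).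
Proof. by move=> c a b; rewrite mulrDr scalerAr. Qed.
Lemma mull_linear (y : A) : linear (fun a => a * y).
Proof. by move=> c a b; rewrite mulrDl scalerAl. Qed.

Lemma outer_act_bimodule : bimodule_action (@outer_act k A).
Proof.
have L x y : linear (fun t : tensor2 A => outer_act x t y).
  exact: (tmap_linear (mulr_linear x) (mull_linear y)).
split=> // [m y c x x'|x m c y y'|x x' m y' y|m].
- apply: (@tensor_ext _ A A (tensor2 A) (fun m => outer_act (c *: x + x') m y)
    (fun m => c *: outer_act x m y + outer_act x' m y)) m => [||a b] //.
    by move=> d a b; rewrite !L !scalerDr addrACA !scalerA mulrC.
  by rewrite !outer_act_pure mulrDl -scalerAl !tpureE.
- apply: (@tensor_ext _ A A (tensor2 A) (fun m => outer_act x m (c *: y + y'))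
    (fun m => c *: outer_act x m y + outer_act x m y')) m => [||a b] //.
    by move=> d a b; rewrite !L !scalerDr addrACA !scalerA mulrC.
  by rewrite !outer_act_pure mulrDr -scalerAr !tpureE.
- apply: (@tensor_ext _ A A (tensor2 A)
    (fun m => outer_act x (outer_act x' m y') y)
    (fun m => outer_act (x * x') m (y' * y))) m => [|//|a b].
    by move=> d a b; rewrite !L.
  by rewrite !outer_act_pure !mulrA.
- apply: (@tensor_ext _ A A (tensor2 A) (fun m => outer_act 1 m 1) id) m
    => // a b.
  by rewrite outer_act_pure mul1r mulr1.
Qed.

Definition outer_act3 (x : A) (t : tensor3 A) (y : A) : tensor3 A :=
  tmap (fun u => outer_act x u 1) (fun c => c * y) t.

Lemma outer_act3_pure2 x u c y :
  outer_act3 x (u ⊗ c) y = outer_act x u 1 ⊗ c * y.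
Proof.
exact: (tmap_pure (act_linear outer_act_bimodule x 1) (mull_linear y)).
Qed.

Lemma outer_act3_pure x a b c y :
  outer_act3 x (a ⊗ b ⊗ c) y = x * a ⊗ b ⊗ c * y.
Proof. by rewrite outer_act3_pure2 outer_act_pure mulr1. Qed.

Lemma outer_act3_bimodule : bimodule_action outer_act3.
Proof.
have L x y : linear (fun t : tensor3 A => outer_act3 x t y).
  exact: (tmap_linear (act_linear outer_act_bimodule x 1) (mull_linear y)).
split=> // [m y c x x'|x m c y y'|x x' m y' y|m].
- apply: (@tensor3_ext _ A A A (tensor3 A)
    (fun m => outer_act3 (c *: x + x') m y)
    (fun m => c *: outer_act3 x m y + outer_act3 x' m y)) m => [||u v w].
  + exact: L.
  + by move=> d a b; rewrite !L !scalerDr addrACA !scalerA mulrC.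
  + by rewrite !outer_act3_pure mulrDl -scalerAl !tpureE.
- apply: (@tensor3_ext _ A A A (tensor3 A)
    (fun m => outer_act3 x m (c *: y + y'))
    (fun m => c *: outer_act3 x m y + outer_act3 x m y')) m => [||u v w].
  + exact: L.
  + by move=> d a b; rewrite !L !scalerDr addrACA !scalerA mulrC.
  + by rewrite !outer_act3_pure mulrDr -scalerAr !tpureE.
- apply: (@tensor3_ext _ A A A (tensor3 A)
    (fun m => outer_act3 x (outer_act3 x' m y') y)
    (fun m => outer_act3 (x * x') m (y' * y))) m => [||u v w].
  + by move=> d a b; rewrite !L.
  + exact: L.
  + by rewrite !outer_act3_pure !mulrA.
- apply: (@tensor3_ext _ A A A (tensor3 A) (fun m => outer_act3 1 m 1) id) m
    => [||u v w] //.
    exact: L.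
  by rewrite outer_act3_pure mul1r mulr1.
Qed.

(** A double bracket is a derivation for the inner structure in its first
    argument, as it is one for the outer structure in its second. *)
Definition inner_act (x : A) (t : tensor2 A) (y : A) : tensor2 A :=
  tau12 (outer_act x (tau12 t) y).

Lemma inner_act_pure x a b y : inner_act x (a ⊗ b) y = a * y ⊗ x * b.
Proof. by rewrite /inner_act tau12_pure outer_act_pure tau12_pure. Qed.

Lemma inner_act_linear x y : linear (fun t => inner_act x t y).
Proof.
move=> c t t'; rewrite /inner_act linearP (act_linear outer_act_bimodule).
by rewrite linearP.
Qed.

Lemma inner_outer_actC x t y x' y' :
  inner_act x (outer_act x' t y') y = outer_act x' (inner_act x t y) y'.
Proof.
apply: (@tensor_ext _ A A (tensor2 A)
    (fun t => inner_act x (outer_act x' t y') y)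
    (fun t => outer_act x' (inner_act x t y) y')) t => [c t t'|c t t'|a b].
- by rewrite (act_linear outer_act_bimodule) inner_act_linear.
- by rewrite inner_act_linear (act_linear outer_act_bimodule).
- by rewrite outer_act_pure !inner_act_pure outer_act_pure !mulrA.
Qed.

End Actions.

Definition outerE {k : fieldType} {A : algType k} :=
  (act0 (outer_act_bimodule A), actD (outer_act_bimodule A),
   actZ (outer_act_bimodule A), actN (outer_act_bimodule A)).

Lemma in_base_base (k : fieldType) (A : algType k) (I : finType) (e : I -> A)
  s : in_base e (e s).
Proof.
exists (fun t => (t == s)%:R).
rewrite (bigD1 s) //= eqxx scale1r big1 ?addr0 //.
by move=> t /negPf ->; rewrite scale0r.
Qed.

(** * The triple bracket of a double bracket *)

Section TripleBracket.
Variables (k : fieldType) (A : algType k) (I : finType) (e : I -> A).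
Variable br : A -> A -> tensor2 A.
Hypothesis brP : double_bracket e br.

Let brL := bracket_bilinear brP.
Let outerP := outer_act_bimodule A.
Let outer3P := outer_act3_bimodule A.

Lemma bracket_derivation a : derivation (@outer_act k A) (br a).
Proof. by split=> [|b c]; [exact: brL.2 | exact: (bracket_Leibniz brP)]. Qed.

Lemma bracket_mull a b c :
  br (a * b) c = inner_act 1 (br a c) b + inner_act a (br b c) 1.
Proof.
rewrite (bracket_antisym brP) (bracket_Leibniz brP) /inner_act.
rewrite [br a c](bracket_antisym brP) [br b c](bracket_antisym brP).
by rewrite !linearN /= !tau12K !(actN outerP) !linearN linearD opprD.
Qed.

Lemma bracketL_linear a : linear (bracketL br a).
Proof.
have H : bilinear_for *:%R *:%R (fun b c : A => br a b ⊗ c).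
  by split=> [v|u] c x y; rewrite ?brL.2 !tpureE.
exact: (tliftP H).2.
Qed.

(** This is the defect of linearity that the Leibniz rule creates when an
    element is moved out of a nested bracket.  It occurs twice in the triple
    bracket, with opposite signs. *)
Definition splice (u : tensor2 A) (t : tensor2 A) : tensor3 A :=
  tmap (fun p => outer_act 1 u p) id t.

Lemma splice_pure u p q : splice u (p ⊗ q) = outer_act 1 u p ⊗ q.
Proof. by rewrite /splice tmap_pure //; apply: (act_linearr outerP). Qed.

Lemma splice_linear u : linear (splice u).
Proof. by apply: tmap_linear => //; apply: (act_linearr outerP). Qed.

Lemma splice_linearl t : linear (splice^~ t).
Proof.
move=> c u u'.
apply: (@tensor_ext _ A A (tensor3 A) (splice (c *: u + u'))
  (fun t => c *: splice u t + splice u' t)) t => [||p q].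
- exact: splice_linear.
- by move=> d x y; rewrite !splice_linear !scalerDr addrACA !scalerA mulrC.
- by rewrite !splice_pure (act_linear outerP) !tpureE.
Qed.

Lemma bracketL_outer_r a t d :
  bracketL br a (outer_act 1 t d) = outer_act3 1 (bracketL br a t) d.
Proof.
apply: (@tensor_ext _ A A (tensor3 A)
  (fun t => bracketL br a (outer_act 1 t d))
  (fun t => outer_act3 1 (bracketL br a t) d)) t => [||p q].
- by move=> c x y; rewrite (act_linear outerP) bracketL_linear.
- by move=> c x y; rewrite bracketL_linear (act_linear outer3P).
- rewrite outer_act_pure !bracketL_pure // outer_act3_pure2 (act1 outerP).
  by rewrite mul1r.
Qed.

Lemma bracketL_outer_l a c t :
  bracketL br a (outer_act c t 1)
  = outer_act3 c (bracketL br a t) 1 + splice (br a c) t.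
Proof.
apply: (@tensor_ext _ A A (tensor3 A)
  (fun t => bracketL br a (outer_act c t 1))
  (fun t => outer_act3 c (bracketL br a t) 1 + splice (br a c) t)) t
  => [||p q].
- by move=> d x y; rewrite (act_linear outerP) bracketL_linear.
- move=> d x y; rewrite bracketL_linear (act_linear outer3P) splice_linear.
  by rewrite scalerDr addrACA.
- rewrite outer_act_pure !bracketL_pure // (bracket_Leibniz brP) tpureDl.
  by rewrite outer_act3_pure2 splice_pure mulr1 addrC.
Qed.

Lemma tau123_outer_r (u : tensor2 A) (q d : A) :
  tau123 (outer_act 1 u d ⊗ q) = outer_act3 1 (tau123 (u ⊗ q)) d.
Proof.
apply: (@tensor_ext _ A A (tensor3 A) (fun u => tau123 (outer_act 1 u d ⊗ q))
  (fun u => outer_act3 1 (tau123 (u ⊗ q)) d)) u => [||s t].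
- by move=> c x y; rewrite (act_linear outerP) !tpureE linearP.
- by move=> c x y; rewrite !tpureE linearP (act_linear outer3P).
- by rewrite outer_act_pure !tau123_pure outer_act3_pure !mul1r.
Qed.

Lemma tau123_outer_l (u : tensor2 A) (p q : A) :
  tau123 (outer_act p u 1 ⊗ q) = splice (q ⊗ p) u.
Proof.
apply: (@tensor_ext _ A A (tensor3 A) (fun u => tau123 (outer_act p u 1 ⊗ q))
  (splice (q ⊗ p))) u => [||s t].
- by move=> c x y; rewrite (act_linear outerP) !tpureE linearP.
- exact: splice_linear.
- by rewrite outer_act_pure tau123_pure splice_pure outer_act_pure mul1r mulr1.
Qed.

Lemma tau123_mid (u : tensor2 A) (c q : A) :
  tau123 (u ⊗ c * q) = outer_act3 c (tau123 (u ⊗ q)) 1.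
Proof.
apply: (@tensor_ext _ A A (tensor3 A) (fun u => tau123 (u ⊗ c * q))
  (fun u => outer_act3 c (tau123 (u ⊗ q)) 1)) u => [||s t].
- by move=> d x y; rewrite !tpureE linearP.
- by move=> d x y; rewrite !tpureE linearP (act_linear outer3P).
- by rewrite !tau123_pure outer_act3_pure mulr1.
Qed.

Lemma tau123_bracketL_inner_r b t d :
  tau123 (bracketL br b (inner_act 1 t d))
  = outer_act3 1 (tau123 (bracketL br b t)) d + splice (tau12 t) (br b d).
Proof.
apply: (@tensor_ext _ A A (tensor3 A)
  (fun t => tau123 (bracketL br b (inner_act 1 t d)))
  (fun t => outer_act3 1 (tau123 (bracketL br b t)) d
            + splice (tau12 t) (br b d))) t => [||p q].
- by move=> c x y; rewrite inner_act_linear bracketL_linear linearP.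
- move=> c x y; rewrite bracketL_linear !linearP (act_linear outer3P).
  by rewrite splice_linearl scalerDr addrACA.
- rewrite inner_act_pure mul1r !bracketL_pure // (bracket_Leibniz brP) tpureDl.
  by rewrite linearD /= tau12_pure tau123_outer_r tau123_outer_l.
Qed.

Lemma tau123_bracketL_inner_l b t c :
  tau123 (bracketL br b (inner_act c t 1))
  = outer_act3 c (tau123 (bracketL br b t)) 1.
Proof.
apply: (@tensor_ext _ A A (tensor3 A)
  (fun t => tau123 (bracketL br b (inner_act c t 1)))
  (fun t => outer_act3 c (tau123 (bracketL br b t)) 1)) t => [||p q].
- by move=> d x y; rewrite inner_act_linear bracketL_linear linearP.
- by move=> d x y; rewrite bracketL_linear !linearP (act_linear outer3P).
- by rewrite inner_act_pure mulr1 !bracketL_pure // tau123_mid.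
Qed.

Lemma tau132_inner_r (u : tensor2 A) (d q : A) :
  tau132 (inner_act 1 u d ⊗ q) = outer_act3 1 (tau132 (u ⊗ q)) d.
Proof.
apply: (@tensor_ext _ A A (tensor3 A) (fun u => tau132 (inner_act 1 u d ⊗ q))
  (fun u => outer_act3 1 (tau132 (u ⊗ q)) d)) u => [||s t].
- by move=> c x y; rewrite inner_act_linear !tpureE linearP.
- by move=> c x y; rewrite !tpureE linearP (act_linear outer3P).
- by rewrite inner_act_pure !tau132_pure outer_act3_pure !mul1r.
Qed.

Lemma tau132_inner_l (u : tensor2 A) (c q : A) :
  tau132 (inner_act c u 1 ⊗ q) = outer_act3 c (tau132 (u ⊗ q)) 1.
Proof.
apply: (@tensor_ext _ A A (tensor3 A) (fun u => tau132 (inner_act c u 1 ⊗ q))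
  (fun u => outer_act3 c (tau132 (u ⊗ q)) 1)) u => [||s t].
- by move=> d x y; rewrite inner_act_linear !tpureE linearP.
- by move=> d x y; rewrite !tpureE linearP (act_linear outer3P).
- by rewrite inner_act_pure !tau132_pure outer_act3_pure !mulr1.
Qed.

Lemma tau132_bracketL_mul c d t :
  tau132 (bracketL br (c * d) t)
  = outer_act3 1 (tau132 (bracketL br c t)) d
    + outer_act3 c (tau132 (bracketL br d t)) 1.
Proof.
apply: (@tensor_ext _ A A (tensor3 A)
  (fun t => tau132 (bracketL br (c * d) t))
  (fun t => outer_act3 1 (tau132 (bracketL br c t)) d
            + outer_act3 c (tau132 (bracketL br d t)) 1)) t => [||p q].
- by move=> a x y; rewrite bracketL_linear linearP.
- move=> a x y; rewrite !bracketL_linear !linearP !(act_linear outer3P).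
  by rewrite scalerDr addrACA.
- rewrite !bracketL_pure // bracket_mull tpureDl linearD /=.
  by rewrite tau132_inner_r tau132_inner_l.
Qed.

Lemma bracketL_linearl t : linear (fun a => bracketL br a t).
Proof.
move=> c a a'.
apply: (@tensor_ext _ A A (tensor3 A) (bracketL br (c *: a + a'))
  (fun t => c *: bracketL br a t + bracketL br a' t)) t => [||p q].
- exact: bracketL_linear.
- by move=> d x y; rewrite !bracketL_linear !scalerDr addrACA !scalerA mulrC.
- by rewrite !bracketL_pure // brL.1 !tpureE.
Qed.

(** Expanding {{a,b,cd}} produces the terms of {{a,b,c}}d and c{{a,b,d}} and two
    terms that splice {{b,d}}, one into {{a,c}} and one into the transpose of
    {{c,a}}.  Antisymmetry makes the latter two cancel. *)
Lemma triple_bracket_derivation a b :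
  derivation (@outer_act3 k A) (triple_bracket br a b).
Proof.
split=> [c x y|c d]; rewrite /triple_bracket.
  rewrite brL.2 brL.1 !bracketL_linear bracketL_linearl !linearP.
  by rewrite !scalerDr [RHS]addrACA [X in _ = X + _]addrACA.
rewrite (bracket_Leibniz brP) bracket_mull !(linear_add (bracketL_linear _)).
rewrite bracketL_outer_r bracketL_outer_l !linearD /= tau123_bracketL_inner_r.
rewrite tau123_bracketL_inner_l tau132_bracketL_mul.
rewrite [tau12 (br c a)](_ : _ = - br a c); last first.
  by rewrite [br a c](bracket_antisym brP) opprK.
rewrite (linear_opp (splice_linearl (br b d))).
rewrite !(actD outer3P).
set p := splice _ _.
rewrite [RHS]addrACA; congr (_ + _); rewrite [RHS]addrACA.
rewrite [X in X + _ = _]addrA [X in _ + X = _]addrAC.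
by rewrite [LHS]addrACA subrr addr0.
Qed.

Lemma triple_bracket_cyclic a b c :
  triple_bracket br a b c = tau123 (triple_bracket br b c a).
Proof.
rewrite /triple_bracket !linearD /= tau123_tau123 tau123_tau132.
by rewrite -[LHS]addrA [LHS]addrC.
Qed.

Lemma triple_bracket_base a b s : triple_bracket br a b (e s) = 0.
Proof.
have eB := in_base_base e s.
rewrite /triple_bracket (bracket_baser brP) // (bracket_basel brP) //.
rewrite !(linear_zero (bracketL_linear _)) !linear0 !add0r.
rewrite [X in tau132 X](_ : _ = 0) ?linear0 //.
apply: (@tensor_ext _ A A (tensor3 A) (bracketL br (e s)) (fun=> 0))
  => [||p q].
- exact: bracketL_linear.
- by move=> c x y; rewrite scaler0 addr0.
- by rewrite bracketL_pure // (bracket_basel brP) // tpure0l.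
Qed.

End TripleBracket.

(** * The quasi-Poisson expression *)

Section TripleQP.
Variables (k : fieldType) (A : algType k) (I : finType) (e : I -> A).
Hypothesis eP : idempotent_base e.

Definition qP_potential (a b : A) : tensor3 A := 4^-1 *: \sum_s
  (e s * a ⊗ e s * b ⊗ e s - e s * a ⊗ e s ⊗ b * e s
   - e s ⊗ a * e s * b ⊗ e s + e s ⊗ a * e s ⊗ b * e s).

(** Each of the last four terms of a summand is minus one of the first four
    with c moved from the left end to the right end: a commutator with c. *)
Lemma triple_qP_inner a b c : triple_qP e a b c =
  outer_act3 c (qP_potential a b) 1 - outer_act3 1 (qP_potential a b) c.
Proof.
have outer3P := outer_act3_bimodule A.
have actS x y (F : I -> tensor3 A) :
    outer_act3 x (\sum_s F s) y = \sum_s outer_act3 x (F s) y.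
  exact: (big_morph (fun m => outer_act3 x m y)
    (fun m m' => actD outer3P x m m' y) (act0 outer3P x y)).
rewrite /triple_qP /qP_potential !(actZ outer3P) -scalerBr !actS -sumrB.
congr (_ *: _); apply: eq_bigr => s _.
rewrite !(actD outer3P, actN outer3P) !outer_act3_pure !mul1r !mulr1 !mulrA.
by rewrite !opprD !opprK !addrA.
Qed.

Lemma triple_qP_derivation a b : derivation (@outer_act3 k A) (triple_qP e a b).
Proof.
rewrite (funext (triple_qP_inner a b)).
exact/inner_derivation/outer_act3_bimodule.
Qed.

Lemma triple_qP_cyclic a b c : triple_qP e a b c = tau123 (triple_qP e b c a).
Proof.
rewrite /triple_qP linearZ /=; congr (_ *: _).
rewrite linear_sum /=; apply: eq_bigr => s _.
rewrite !(linearD, linearN) /= !tau123_pure.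
(* tau_(123) permutes the eight terms of each summand in this way. *)
by rewrite [LHS](ACl (7*3*8*4*5*1*6*2)).
Qed.

Lemma triple_qP_base a b t : triple_qP e a b (e t) = 0.
Proof.
rewrite /triple_qP big1 ?scaler0 // => s _.
rewrite -!(mulrA b) !(base_orthogonal eP) [t == s]eq_sym.
case: eqP => [->|_]; rewrite ?(mul0r, mulr0, tpure0l, tpure0r, subr0, addr0) //.
(* For s = t all factors e t are absorbed and the terms cancel in pairs. *)
by rewrite [LHS](ACl ((1*5)*(6*2)*(7*3)*(4*8))) /= !subrr !addr0.
Qed.

End TripleQP.

(** * Linear identities in a module, by comparison of coefficients *)

Section LinearReflection.
Variable k : fieldType.

Inductive lexpr :=
  | LAtom of nat
  | LZero
  | LAdd of lexpr & lexpr
  | LOpp of lexpr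
  | LScale of k & lexpr.

Fixpoint lexpr_eval (V : lmodType k) (env : seq V) (x : lexpr) : V :=
  match x with
  | LAtom i => nth 0 env i
  | LZero => 0
  | LAdd x y => lexpr_eval env x + lexpr_eval env y
  | LOpp x => - lexpr_eval env x
  | LScale c x => c *: lexpr_eval env x
  end.

Fixpoint lexpr_coef (x : lexpr) (i : nat) : k :=
  match x with
  | LAtom j => if eqn j i then 1 else 0
  | LZero => 0
  | LAdd x y => lexpr_coef x i + lexpr_coef y i
  | LOpp x => - lexpr_coef x i
  | LScale c x => c * lexpr_coef x i
  end.

(** A conjunction rather than a quantification over indices, so that it
    computes to one scalar equation for each atom. *)
Fixpoint same_coefs (n : nat) (x y : lexpr) : Prop :=
  if n is n'.+1 then lexpr_coef x n' = lexpr_coef y n' /\ same_coefs n' x y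
  else True.

Lemma lexpr_evalE (V : lmodType k) (env : seq V) x :
  lexpr_eval env x = \sum_(i < size env) lexpr_coef x i *: nth 0 env i.
Proof.
elim: x => [j||x IHx y IHy|x IHx|c x IHx] /=.
- have [le_j|lt_j] := leqP (size env) j.
    rewrite nth_default // big1 // => i _; case: eqnP => [ji|_].
      by move: (ltn_ord i); rewrite -ji ltnNge le_j.
    by rewrite scale0r.
  rewrite (bigD1 (Ordinal lt_j)) //= [eqn j j]eqxx scale1r big1 ?addr0 // => i.
  rewrite -val_eqE /= => ij; case: eqnP => [ji|_]; last by rewrite scale0r.
  by rewrite ji eqxx in ij.
- by rewrite big1 // => i _; rewrite scale0r.
- by rewrite IHx IHy -big_split; apply: eq_bigr => i _; rewrite scalerDl.
- by rewrite IHx -sumrN; apply: eq_bigr => i _; rewrite scaleNr.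
- by rewrite IHx scaler_sumr; apply: eq_bigr => i _; rewrite scalerA.
Qed.

Lemma lexpr_evalP (V : lmodType k) (env : seq V) x y :
  same_coefs (size env) x y -> lexpr_eval env x = lexpr_eval env y.
Proof.
move=> xy; rewrite !lexpr_evalE; apply: eq_bigr => i _; congr (_ *: _).
elim: (size env) xy (nat_of_ord i) (ltn_ord i) => // n IHn /= [xyn xy] j.
by rewrite ltnS leq_eqVlt => /predU1P [->//|]; apply: IHn.
Qed.

End LinearReflection.

(* Equal monomials may carry different but convertible ring structures, so
   that a syntactic comparison would take them for distinct atoms. *)
Ltac same_atom x y :=
  first [constr_eq x y |
  lazymatch x with
  | GRing.mul ?x1 ?x2 =>
    lazymatch y with
    | GRing.mul ?y1 ?y2 => same_atom x1 y1; same_atom x2 y2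
    end
  | tpure ?x1 ?x2 =>
    lazymatch y with
    | tpure ?y1 ?y2 => same_atom x1 y1; same_atom x2 y2
    end
  end].

Ltac lmod_index x env :=
  lazymatch env with
  | ?y :: ?env' =>
    match constr:(Set) with
    | _ => let _ := match constr:(Set) with _ => same_atom x y end in
           constr:(O)
    | _ => let n := lmod_index x env' in constr:(S n)
    end
  end.

Ltac lmod_atoms env t :=
  lazymatch t with
  | Algebra.zero => env
  | Algebra.add ?x ?y => let env' := lmod_atoms env x in lmod_atoms env' y
  | Algebra.opp ?x => lmod_atoms env x
  | GRing.scale ?c ?x => lmod_atoms env x
  | ?x =>
    match constr:(Set) with
    | _ => let _ := lmod_index x env in env
    | _ => constr:(x :: env)
    end
  end.

Ltac lmod_reify k env t :=
  lazymatch t with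
  | Algebra.zero => constr:(@LZero k)
  | Algebra.add ?x ?y =>
    let x' := lmod_reify k env x in
    let y' := lmod_reify k env y in constr:(LAdd x' y')
  | Algebra.opp ?x => let x' := lmod_reify k env x in constr:(LOpp x')
  | GRing.scale ?c ?x =>
    let x' := lmod_reify k env x in constr:(@LScale k c x')
  | ?x => let n := lmod_index x env in constr:(@LAtom k n)
  end.

(* Reduces an equation between linear combinations in the k-module V to the
   equality of the coefficients of each atom, which is left to ring and
   field. *)
Ltac lmod k V :=
  lazymatch goal with
  | |- ?s = ?t =>
    let env := lmod_atoms (@nil V) s in
    let env := lmod_atoms env t in
    let s' := lmod_reify k env s in
    let t' := lmod_reify k env t in
    refine (@lexpr_evalP k V env s' t' _);
    cbn [same_coefs lexpr_coef size eqn];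
    repeat (split; [first [reflexivity | ring | by field] | ]); exact I
  end.

(** * The Boalch algebra as a localized path algebra *)

Lemma vtx1_neq2 : (vtx1 == vtx2) = false. Proof. by []. Qed.
Lemma vtx2_neq1 : (vtx2 == vtx1) = false. Proof. by []. Qed.

Lemma vtxP (i : 'I_2) : i = vtx1 \/ i = vtx2.
Proof.
by case: i => [[|[|//]]] lt_i; [left | right]; apply: val_inj.
Qed.

Lemma sum_vtx (V : nmodType) (F : 'I_2 -> V) :
  \sum_s F s = F vtx1 + F vtx2.
Proof.
rewrite big_ord_recl big_ord1; congr (_ + F _); exact: val_inj.
Qed.

Section BoalchDatum.
Variables (k : fieldType) (A : algType k).
Variables (E : 'I_2 -> A) (a b h : A).

(** What determines a map from the Boalch algebra to A.  One inverse suffices: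
    that of e_1 + ab is then e_1 - ahb, see [corner_inverse]. *)
Record boalch_datum : Prop := BoalchDatum {
  datum_base : idempotent_base E;
  datum_v12 : a = E vtx1 * a * E vtx2;
  datum_v21 : b = E vtx2 * b * E vtx1;
  datum_h : h = E vtx2 * h * E vtx2;
  datum_hr : (E vtx2 + b * a) * h = E vtx2;
  datum_hl : h * (E vtx2 + b * a) = E vtx2
}.

Lemma base_sum2 : idempotent_base E -> 1 = E vtx1 + E vtx2.
Proof. by move=> /base_unital ->; apply: sum_vtx. Qed.

Hypothesis dP : boalch_datum.
Let eP := datum_base dP.

Lemma mul_ee i j : E i * E j = if i == j then E i else 0.
Proof. exact: base_orthogonal. Qed.
Lemma mul_ea i : E i * a = if i == vtx1 then a else 0.
Proof. exact: corner_mull (datum_v12 dP). Qed.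
Lemma mul_ae i : a * E i = if vtx2 == i then a else 0.
Proof. exact: corner_mulr (datum_v12 dP). Qed.
Lemma mul_eb i : E i * b = if i == vtx2 then b else 0.
Proof. exact: corner_mull (datum_v21 dP). Qed.
Lemma mul_be i : b * E i = if vtx1 == i then b else 0.
Proof. exact: corner_mulr (datum_v21 dP). Qed.
Lemma mul_eh i : E i * h = if i == vtx2 then h else 0.
Proof. exact: corner_mull (datum_h dP). Qed.
Lemma mul_he i : h * E i = if vtx2 == i then h else 0.
Proof. exact: corner_mulr (datum_h dP). Qed.
Lemma mul_aa : a * a = 0.
Proof. exact: corner_mul0 (datum_v12 dP) (datum_v12 dP) _. Qed.
Lemma mul_bb : b * b = 0.
Proof. exact: corner_mul0 (datum_v21 dP) (datum_v21 dP) _. Qed.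
Lemma mul_ha : h * a = 0.
Proof. exact: corner_mul0 (datum_h dP) (datum_v12 dP) _. Qed.
Lemma mul_bh : b * h = 0.
Proof. exact: corner_mul0 (datum_v21 dP) (datum_h dP) _. Qed.
Lemma mul_bah : b * (a * h) = E vtx2 - h.
Proof.
have := datum_hr dP; rewrite mulrDl mul_eh eqxx -mulrA => <-.
by rewrite [X in _ = X - _]addrC addrK.
Qed.
Lemma mul_hba : h * (b * a) = E vtx2 - h.
Proof.
have := datum_hl dP; rewrite mulrDr mul_he eqxx => <-.
by rewrite [X in _ = X - _]addrC addrK.
Qed.
Lemma mul_baht t : b * (a * (h * t)) = (E vtx2 - h) * t.
Proof. by rewrite -mul_bah !mulrA. Qed.
Lemma mul_hbat t : h * (b * (a * t)) = (E vtx2 - h) * t.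
Proof. by rewrite -mul_hba !mulrA. Qed.

(** Reduces right-associated words in the E i, a, b, h, after distributing
    products over sums. *)
Definition mulE :=
  (mul_ee, mul_ea, mul_ae, mul_eb, mul_be, mul_eh, mul_he,
   (fun i j => mul_tail (mul_ee i j)),
   (fun i => mul_tail (mul_ea i)), (fun i => mul_tail (mul_ae i)),
   (fun i => mul_tail (mul_eb i)), (fun i => mul_tail (mul_be i)),
   (fun i => mul_tail (mul_eh i)), (fun i => mul_tail (mul_he i)),
   mul_aa, mul_bb, mul_ha, mul_bh, mul_tail mul_aa, mul_tail mul_bb,
   mul_tail mul_ha, mul_tail mul_bh, mul_bah, mul_hba, mul_baht, mul_hbat,
   mulrDl, mulrDr, mulrN, mulNr, mul0r, mulr0, mul1r, mulr1, eqxx,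
   vtx1_neq2, vtx2_neq1, addr0, add0r, oppr0).

Local Notation g1 := (E vtx1 - a * h * b).

(** The identity (1 + ab)^-1 = 1 - a(1 + ba)^-1 b, read in the corner of the
    first idempotent. *)
Lemma corner_inverse :
  (E vtx1 + a * b) * g1 = E vtx1 /\ g1 * (E vtx1 + a * b) = E vtx1.
Proof.
by split; do 4 rewrite -?mulrA ?mulE /=; lmod k A.
Qed.

Definition boalch_gen_val (x : boalch_gen) : A :=
  match x with
  | Ge i => E i
  | Gv12 => a
  | Gv21 => b
  | Gw12 => a * h
  | Gw21 => h * b
  | Ggamma i => if i == vtx1 then g1 else E vtx2 + b * a
  | GgammaV i => if i == vtx1 then E vtx1 + a * b else h
  end.

Lemma boalch_gen_val_rel s t :
  boalch_rel s t -> alg_eval boalch_gen_val s = alg_eval boalch_gen_val t.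
Proof.
have [K1 K2] := corner_inverse.
case=> [|i j|||||i|i|i|i|] /=.
- exact: base_sum2.
- by rewrite (base_orthogonal eP); case: eqP.
- exact: datum_v12.
- exact: datum_v21.
- by rewrite -?mulrA ?mulE /=.
- by rewrite -?mulrA ?mulE /=.
- by have [->|->] := vtxP i; do 4 rewrite -?mulrA ?mulE /=.
- by have [->|->] := vtxP i; do 4 rewrite -?mulrA ?mulE /=.
- by have [->|->] := vtxP i; rewrite ?eqxx //= datum_hr.
- by have [->|->] := vtxP i; rewrite ?eqxx //= datum_hl.
- rewrite (base_sum2 eP); do 4 rewrite -?mulrA ?mulE /=; lmod k A.
Qed.

End BoalchDatum.

Section FactorizationComponents.
Variables (k : fieldType) (A : algType k) (E : 'I_2 -> A).
Variables (a b w w' g1 g2 : A).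
Hypotheses (eP : idempotent_base E).
Hypotheses (aP : a = E vtx1 * a * E vtx2) (bP : b = E vtx2 * b * E vtx1).
Hypotheses (wP : w = E vtx1 * w * E vtx2) (w'P : w' = E vtx2 * w' * E vtx1).
Hypotheses (g1P : g1 = E vtx1 * g1 * E vtx1) (g2P : g2 = E vtx2 * g2 * E vtx2).
Hypothesis factorization : (1 + b) * (1 + a) = (1 + w) * (g1 + g2) * (1 + w').

(** The factors 1 + w and 1 + w' are unitriangular for the decomposition of 1
    into idempotents, so the corner at the second vertex involves g2 alone and
    the other three corners can be solved successively. *)
Lemma factorization_components :
  [/\ E vtx2 + b * a = g2, a = w * g2, b = g2 * w'
    & E vtx1 = g1 + w * (g2 * w')].
Proof.
have L i x j l xP := @corner_mull _ _ _ _ eP i l j x xP.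
have R i x j l xP := @corner_mulr _ _ _ _ eP i j l x xP.
have Lt i x j l xP := mul_tail (L i x j l xP).
have Rt i x j l xP := mul_tail (R i x j l xP).
have EE i j := mul_tail (base_orthogonal eP i j).
pose rules := (base_orthogonal eP, EE,
  (L _ _ _ _ aP, L _ _ _ _ bP, L _ _ _ _ wP, L _ _ _ _ w'P),
  (R _ _ _ _ aP, R _ _ _ _ bP, R _ _ _ _ wP, R _ _ _ _ w'P),
  (L _ _ _ _ g1P, L _ _ _ _ g2P, R _ _ _ _ g1P, R _ _ _ _ g2P),
  (Lt _ _ _ _ aP, Lt _ _ _ _ bP, Lt _ _ _ _ wP, Lt _ _ _ _ w'P),
  (Rt _ _ _ _ aP, Rt _ _ _ _ bP, Rt _ _ _ _ wP, Rt _ _ _ _ w'P),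
  (Lt _ _ _ _ g1P, Lt _ _ _ _ g2P, Rt _ _ _ _ g1P, Rt _ _ _ _ g2P),
  (mulrDl, mulrDr, mul0r, mulr0, mul1r, mulr1),
  (eqxx, vtx1_neq2, vtx2_neq1, addr0, add0r)).
have component i j := congr1 (fun x => E i * x * E j) factorization.
split.
- by move: (component vtx2 vtx2); do 4 rewrite -?mulrA ?rules /=.
- by move: (component vtx1 vtx2); do 4 rewrite -?mulrA ?rules /=.
- by move: (component vtx2 vtx1); do 4 rewrite -?mulrA ?rules /=.
- have g1w' : g1 * w' = 0 by apply: (corner_mul0 eP g1P w'P).
  have wg1 : w * g1 = 0 by apply: (corner_mul0 eP wP g1P).
  by move: (component vtx1 vtx1); do 4 rewrite -?mulrA ?rules ?g1w' ?wg1 /=.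
Qed.

End FactorizationComponents.

Section BoalchAlgebra.
Variable k : fieldType.
Local Notation B := (boalch k).
Local Notation E := (@boalch_e k).
Local Notation a := (boalch_v12 k).
Local Notation b := (boalch_v21 k).
Local Notation gen := (pgen (@boalch_rel k) : boalch_gen -> B).

Lemma alg_eval_gen s : alg_eval gen s = pcls (@boalch_rel k) s.
Proof.
elim: s => //= [s -> t ->|c s ->|s -> t ->].
- exact: pcls_add.
- exact: pcls_scale.
- exact: pcls_mul.
Qed.

Lemma boalch_relE s t : boalch_rel s t -> alg_eval gen s = alg_eval gen t.
Proof. by move=> st; rewrite !alg_eval_gen; apply/pclsP/ac_rel. Qed.

Lemma boalch_base : idempotent_base E.
Proof.
split=> [i j|].
  by have := boalch_relE (br_idem k i j); rewrite /=; case: eqP.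
by rewrite sum_vtx; apply: (boalch_relE (br_unit k)).
Qed.

Let boalch_components := factorization_components boalch_base
  (boalch_relE (br_v12 k)) (boalch_relE (br_v21 k)) (boalch_relE (br_w12 k))
  (boalch_relE (br_w21 k)) (boalch_relE (br_gamma k vtx1))
  (boalch_relE (br_gamma k vtx2)) (boalch_relE (br_main k)).

Lemma boalch_gamma2E : boalch_gamma k vtx2 = E vtx2 + b * a.
Proof. by case: boalch_components. Qed.

Lemma boalch_datumP : boalch_datum E a b (gen (GgammaV vtx2)).
Proof.
split; first exact: boalch_base.
- exact: (boalch_relE (br_v12 k)).
- exact: (boalch_relE (br_v21 k)).
- exact: (boalch_relE (br_gammaV k vtx2)).
- by rewrite -boalch_gamma2E; apply: (boalch_relE (br_gammaK k vtx2)).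
- by rewrite -boalch_gamma2E; apply: (boalch_relE (br_gammaVK k vtx2)).
Qed.

Lemma boalch_w12E : gen Gw12 = a * gen (GgammaV vtx2).
Proof.
have [_ /= aE _ _] := boalch_components; rewrite /boalch_v12 aE.
rewrite -mulrA [_ * gen (GgammaV _)](boalch_relE (br_gammaK k vtx2)) /=.
by rewrite (corner_mulr boalch_base _ (boalch_relE (br_w12 k))) eqxx.
Qed.

Lemma boalch_w21E : gen Gw21 = gen (GgammaV vtx2) * b.
Proof.
have [_ _ /= bE _] := boalch_components; rewrite /boalch_v21 bE.
rewrite mulrA [gen (GgammaV _) * _](boalch_relE (br_gammaVK k vtx2)) /=.
by rewrite (corner_mull boalch_base _ (boalch_relE (br_w21 k))) eqxx.
Qed.

Lemma boalch_gamma1E :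
  boalch_gamma k vtx1 = E vtx1 - a * gen (GgammaV vtx2) * b.
Proof.
have [_ _ /= bE e1E] := boalch_components.
by rewrite e1E -bE -boalch_w12E addrK.
Qed.

(** An element of the corner has at most one inverse there, and gamma_1 is
    already inverse to e_1 + ab. *)
Lemma boalch_gammaV1E : gen (GgammaV vtx1) = E vtx1 + a * b.
Proof.
have [K _] := corner_inverse boalch_datumP.
have gVP := boalch_relE (br_gammaV k vtx1).
have -> : gen (GgammaV vtx1) = E vtx1 * gen (GgammaV vtx1).
  by rewrite (corner_mull boalch_base _ gVP) eqxx.
rewrite -{1}K -boalch_gamma1E -mulrA.
rewrite [_ * gen (GgammaV _)](boalch_relE (br_gammaK k vtx1)) /=.
rewrite mulrDl -mulrA (base_orthogonal boalch_base) eqxx.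
by rewrite (mul_be boalch_datumP) eqxx.
Qed.

(** Up to inverses taken in the corners e_i B e_i, the algebra is generated by
    the idempotents, v_12 and v_21.  Closure under inversion is what the
    derivation property provides. *)
Lemma boalch_ind (P : B -> Prop) :
  (forall c x y, P x -> P y -> P (c *: x + y)) ->
  (forall x y, P x -> P y -> P (x * y)) ->
  (forall i, P (E i)) -> P a -> P b ->
  (forall i x y, y = E i * y * E i -> x * y = E i -> y * x = E i ->
     P x -> P y) ->
  forall x, P x.
Proof.
move=> PL PM PE Pa Pb PV.
have PD x y : P x -> P y -> P (x + y).
  by move=> Px Py; rewrite -[x]scale1r; apply: PL.
have P0 : P 0 by rewrite -(addNr a) -scaleN1r; apply: PL.
have Pg2 : P (boalch_gamma k vtx2) by rewrite boalch_gamma2E; auto.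
have PgV1 : P (gen (GgammaV vtx1)) by rewrite boalch_gammaV1E; auto.
have PgV2 : P (gen (GgammaV vtx2)).
  apply: PV Pg2; first exact: (boalch_relE (br_gammaV k vtx2)).
    exact: (boalch_relE (br_gammaK k vtx2)).
  exact: (boalch_relE (br_gammaVK k vtx2)).
have Pg1 : P (boalch_gamma k vtx1).
  apply: PV PgV1; first exact: (boalch_relE (br_gamma k vtx1)).
    exact: (boalch_relE (br_gammaVK k vtx1)).
  exact: (boalch_relE (br_gammaK k vtx1)).
elim/pclsW=> s; rewrite -alg_eval_gen.
elim: s => [x|||s Ps t Pt|c s Ps|s Ps t Pt] /=; last 3 first.
- exact: PD.
- by rewrite -[c *: _]addr0; apply: PL.
- exact: PM.
- case: x => [i|||||i|i] /=.
  + exact: PE.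
  + exact: Pa.
  + exact: Pb.
  + by rewrite boalch_w12E; auto.
  + by rewrite boalch_w21E; auto.
  + by have [->|->] := vtxP i.
  + by have [->|->] := vtxP i.
- exact: P0.
- by rewrite (base_sum2 (boalch_base)); apply: PD; apply: PE.
Qed.

Section Derivations.
Variables (M : lmodType k) (act : B -> M -> B -> M).
Hypothesis actP : bimodule_action act.

(** If y is inverse to x in the corner of e_i, then D(yx) = D(e_i) gives
    D(y)x = D(e_i) - y D(x), and multiplying by y on the right recovers D(y)
    from D(x) and D(e_i). *)
Lemma derivation_ext (D D' : B -> M) : derivation act D -> derivation act D' ->
  (forall i, D (E i) = D' (E i)) -> D a = D' a -> D b = D' b -> D =1 D'.
Proof.
move=> DP D'P eqE eqa eqb; elim/boalch_ind=> //.
- by move=> c x y xP yP; rewrite (der_linear DP) (der_linear D'P) xP yP.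
- by move=> x y xP yP; rewrite (der_mul DP) (der_mul D'P) xP yP.
move=> i x y yP xy yx xP.
have yE : y = y * E i by rewrite (corner_mulr boalch_base _ yP) eqxx.
have split_der F : derivation act F ->
    F y = act 1 (act 1 (F y) x) y + act y (F (E i)) 1.
  by move=> FP; rewrite (actA actP) mulr1 xy -(der_mul FP) -yE.
have eqyx : act 1 (D y) x = act 1 (D' y) x.
  have : D (y * x) = D' (y * x) by rewrite yx.
  by rewrite (der_mul DP) (der_mul D'P) xP => /addIr.
by rewrite (split_der D) // (split_der D') // eqyx eqE.
Qed.

End Derivations.

End BoalchAlgebra.

(** * Derivations as sections of square-zero extensions *)

Section SquareZero.
Variables (k : fieldType) (A : algType k) (M : lmodType k).
Variable act : A -> M -> A -> M.

(** A map x |-> (x, D x) to this algebra is multiplicative exactly when D is a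
    derivation.  The proof that act is an action is a parameter of the type so
    that the ring structure can be inferred from the type. *)
Definition square_zero (actP : bimodule_action act) : Type := (A * M)%type.

Variable actP : bimodule_action act.
Local Notation S := (square_zero actP).

HB.instance Definition _ := GRing.Lmodule.copy S (A * M)%type.

Definition sqz_mul (x y : S) : S :=
  (x.1 * y.1, act 1 x.2 y.1 + act x.1 y.2 1).

Let sqz_mulA : associative sqz_mul.
Proof.
move=> x y z; congr (_, _); rewrite /= ?mulrA //.
by rewrite !(actD actP) !(actA actP) !mul1r !mulr1 addrA.
Qed.

Let sqz_mul1l : left_id ((1, 0) : S) sqz_mul.
Proof.
move=> x; rewrite /sqz_mul /= mul1r (act0 actP) add0r (act1 actP).
by case: x.
Qed.

Let sqz_mul1r : right_id ((1, 0) : S) sqz_mul.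
Proof.
move=> x; rewrite /sqz_mul /= mulr1 (act0 actP) addr0 (act1 actP).
by case: x.
Qed.

Let sqz_mulDl : left_distributive sqz_mul +%R.
Proof.
move=> x y z; congr (_, _); rewrite /= ?mulrDl //.
by rewrite (actD actP) (linear_add (act_linearl actP _ _)) addrACA.
Qed.

Let sqz_mulDr : right_distributive sqz_mul +%R.
Proof.
move=> x y z; congr (_, _); rewrite /= ?mulrDr //.
by rewrite (actD actP) (linear_add (act_linearr actP _ _)) addrACA.
Qed.

Let sqz_neq0 : ((1, 0) : S) != 0.
Proof. by apply/eqP => -[] /eqP; rewrite oner_eq0. Qed.

HB.instance Definition _ := GRing.Zmodule_isNzRing.Build S
  sqz_mulA sqz_mul1l sqz_mul1r sqz_mulDl sqz_mulDr sqz_neq0.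

Let sqz_scaleAl (c : k) (x y : S) : c *: (x * y) = (c *: x) * y.
Proof.
congr (_, _); rewrite /= ?scalerAl // (actZ actP).
by rewrite (linear_scale (act_linearl actP _ _)) scalerDr.
Qed.
HB.instance Definition _ := GRing.Lmodule_isLalgebra.Build k S sqz_scaleAl.

Let sqz_scaleAr (c : k) (x y : S) : c *: (x * y) = x * (c *: y).
Proof.
congr (_, _); rewrite /= ?scalerAr // (actZ actP).
by rewrite (linear_scale (act_linearr actP _ _)) scalerDr.
Qed.
HB.instance Definition _ := GRing.Lalgebra_isAlgebra.Build k S sqz_scaleAr.

Lemma sqz_mulE (x y : S) : x * y = (x.1 * y.1, act 1 x.2 y.1 + act x.1 y.2 1).
Proof. by []. Qed.

Lemma sqz_eq (x y : S) : x.1 = y.1 -> x.2 = y.2 -> x = y.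
Proof. by case: x y => [? ?] [? ?] /= -> ->. Qed.

Section Datum.
Variables (E : 'I_2 -> A) (a b h : A) (m n : M).
Hypothesis dP : boalch_datum E a b h.
Let eP := datum_base dP.

Let m' := act (E vtx1) m (E vtx2).
Let n' := act (E vtx2) n (E vtx1).
(* The value at e_2 + ba of a derivation that maps a to m' and b to n'; at the
   inverse h it must then take the value - h d' h. *)
Let d' := act 1 n' a + act b m' 1.

Lemma square_zero_datum :
  boalch_datum (fun i => (E i, 0) : S) ((a, m') : S) ((b, n') : S)
    ((h, - act h d' h) : S).
Proof.
have dl : act (E vtx2) d' 1 = d'.
  rewrite /d' /m' /n' !(actD actP) !(actA actP).
  by do 3 rewrite -?mulrA ?(mulE dP) /=.
have dr : act 1 d' (E vtx2) = d'.
  rewrite /d' /m' /n' !(actD actP) !(actA actP).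
  by do 3 rewrite -?mulrA ?(mulE dP) /=.
have g2E : ((E vtx2, 0) : S) + ((b, n') : S) * ((a, m') : S)
    = (E vtx2 + b * a, d').
  by apply: sqz_eq => //=; rewrite add0r.
have inverse_r d : act (E vtx2) d 1 = d ->
    ((E vtx2 + b * a, d) : S) * ((h, - act h d h) : S) = (E vtx2, 0).
  move=> dE; apply: sqz_eq => /=; first exact: (datum_hr dP).
  by rewrite -[in act 1 d h]dE !(actN actP) !(actA actP) (datum_hr dP)
    !(mul1r, mulr1) subrr.
have inverse_l d : act 1 d (E vtx2) = d ->
    ((h, - act h d h) : S) * ((E vtx2 + b * a, d) : S) = (E vtx2, 0).
  move=> dE; apply: sqz_eq => /=; first exact: (datum_hl dP).
  by rewrite -[in act h d 1]dE !(actN actP) !(actA actP) (datum_hl dP)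
    !(mul1r, mulr1) addNr.
split.
- split=> [i j|].
    rewrite sqz_mulE /= !(act0 actP) addr0 (base_orthogonal eP).
    by case: (i == j); apply: sqz_eq.
  rewrite sum_vtx; apply: sqz_eq; last exact/esym/addr0.
  exact: base_sum2.
- apply: sqz_eq => /=; first exact: (datum_v12 dP).
  rewrite !(act0 actP, add0r, addr0) !(actA actP) !(mulr1, mul1r).
  by do 2 rewrite ?(mulE dP) /=.
- apply: sqz_eq => /=; first exact: (datum_v21 dP).
  rewrite !(act0 actP, add0r, addr0) !(actA actP) !(mulr1, mul1r).
  by do 2 rewrite ?(mulE dP) /=.
- apply: sqz_eq => /=; first exact: (datum_h dP).
  rewrite !(act0 actP, add0r, addr0) !(actN actP) !(actA actP).
  by do 2 rewrite ?(mulE dP) /=.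
- by rewrite g2E (inverse_r _ dl).
- by rewrite g2E (inverse_l _ dr).
Qed.

End Datum.
End SquareZero.

Section BoalchDerivation.
Variable k : fieldType.
Local Notation B := (boalch k).
Local Notation E := (@boalch_e k).
Local Notation a := (boalch_v12 k).
Local Notation b := (boalch_v21 k).
Variables (M : lmodType k) (act : B -> M -> B -> M).
Hypothesis actP : bimodule_action act.

Definition base_derivation (D : B -> M) :=
  derivation act D /\ forall i, D (E i) = 0.

(** The second component of the algebra map that [square_zero_datum] induces.
    Its first component fixes the generators, hence is the identity. *)
Lemma base_derivation_exists (m n : M) : exists D : B -> M,
  [/\ base_derivation D, D a = act (E vtx1) m (E vtx2)
    & D b = act (E vtx2) n (E vtx1)].
Proof.
have dP := square_zero_datum actP m n (boalch_datumP k).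
have [gX gL g1 gM] := presented_evalP (boalch_gen_val_rel dP).
set g := presented_eval _ in gX gL g1 gM.
have fstE x : (g x).1 = x.
  elim/boalch_ind: x => [c x y xP yP|x y xP yP|i|||i x y yP xy yx xP].
  - by rewrite gL /= xP yP.
  - by rewrite gM /= xP yP.
  - by rewrite gX.
  - by rewrite gX.
  - by rewrite gX.
  have gE : (g (E i)).1 = E i by rewrite gX.
  have xgy : x * (g y).1 = E i by rewrite -{1}xP -gE -xy gM.
  have yE : y * E i = y by rewrite (corner_mulr (boalch_base k) _ yP) eqxx.
  rewrite -[RHS]yE -xgy mulrA yx -gE.
  have Ey : E i * y = y by rewrite (corner_mull (boalch_base k) _ yP) eqxx.
  by rewrite -[in LHS]Ey gM.
exists (fun x => (g x).2); split.
- split=> [|i]; last by rewrite gX.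
  split=> [c x y|x y]; first by rewrite gL.
  by rewrite gM /= !fstE.
- by rewrite gX.
- by rewrite gX.
Qed.

Lemma base_derivation_ext (D D' : B -> M) :
  base_derivation D -> base_derivation D' ->
  D a = D' a -> D b = D' b -> D =1 D'.
Proof.
move=> [DP DE] [D'P D'E]; apply: (derivation_ext actP DP D'P) => i.
by rewrite DE D'E.
Qed.

End BoalchDerivation.

(** * Existence and uniqueness of the bracket *)

Section BoalchBracket.
Variable k : fieldType.
Local Notation B := (boalch k).
Local Notation E := (@boalch_e k).
Local Notation a := (boalch_v12 k).
Local Notation b := (boalch_v21 k).
Local Notation outer_base_derivation := (base_derivation (@outer_act k B)).

Let outerP := outer_act_bimodule B.
Let dP := boalch_datumP k.
Let outer_ext D D' := @base_derivation_ext k _ _ outerP D D'.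

(** The inner and the outer structures commute. *)
Lemma inner_act_derivation x y (D : B -> tensor2 B) :
  outer_base_derivation D ->
  outer_base_derivation (fun c => inner_act x (D c) y).
Proof.
move=> [[DL DM] DE]; split=> [|i]; last first.
  by rewrite DE (linear_zero (inner_act_linear x y)).
split=> [c u v|u v]; first by rewrite DL inner_act_linear.
by rewrite DM (linear_add (inner_act_linear x y)) !inner_outer_actC.
Qed.

Lemma base_derivation_scale_add c (D D' : B -> tensor2 B) :
  outer_base_derivation D -> outer_base_derivation D' ->
  outer_base_derivation (fun x => c *: D x + D' x).
Proof.
move=> [DP DE] [D'P D'E]; split; first exact: derivation_scale_add.
by move=> i; rewrite DE D'E scaler0 addr0.
Qed.

Lemma double_bracket_base_derivation (br : B -> B -> tensor2 B) c :
  double_bracket E br -> outer_base_derivation (br c).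
Proof.
move=> brP; split; first exact: (bracket_derivation brP).
by move=> i; rewrite (bracket_baser brP) //; apply: in_base_base.
Qed.

(** Two double brackets {{c,-}} agree once they do so at a and b, and by
    antisymmetry these values are given by {{a,c}} and {{b,c}}, where the same
    reduction applies to c. *)
Lemma double_bracket_ext (br br' : B -> B -> tensor2 B) :
  double_bracket E br -> double_bracket E br' ->
  br a a = br' a a -> br a b = br' a b ->
  br b a = br' b a -> br b b = br' b b -> br =2 br'.
Proof.
move=> brP br'P aa ab ba bb c.
have der x := double_bracket_base_derivation x brP.
have der' x := double_bracket_base_derivation x br'P.
refine (outer_ext (der c) (der' c) _ _);
  rewrite (bracket_antisym brP) (bracket_antisym br'P);
  congr (- tau12 _); refine (outer_ext (der _) (der' _) _ _ _) => //.
Qed.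

Let gen_der (m n : tensor2 B) :=
  sval (cid (base_derivation_exists outerP m n)).

Let gen_derP m n : [/\ outer_base_derivation (gen_der m n),
  gen_der m n a = outer_act (E vtx1) m (E vtx2)
  & gen_der m n b = outer_act (E vtx2) n (E vtx1)].
Proof. exact: (svalP (cid (base_derivation_exists outerP m n))). Qed.

Let val21 : tensor2 B :=
  E vtx1 ⊗ E vtx2 + 2^-1 *: (a * b ⊗ E vtx2 + E vtx1 ⊗ b * a).
Let val12 : tensor2 B :=
  - (E vtx2 ⊗ E vtx1) - 2^-1 *: (E vtx2 ⊗ a * b + b * a ⊗ E vtx1).

Let tau_val21 : - tau12 val21 = val12.
Proof.
have L := @tau12_linear k B.
rewrite /val21 /val12 !(linear_add L, linear_scale L) !tau12_pure opprD.
by rewrite [X in _ - _ *: X]addrC.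
Qed.

Let tau_val12 : - tau12 val12 = val21.
Proof. by rewrite -tau_val21 linearN /= tau12K opprK. Qed.

(* The prescribed values lie in the corners that the idempotents around v_12
   and v_21 impose, for the inner structure in the first argument and for the
   outer structure in the second. *)
Let val21_inner : inner_act (E vtx2) val21 (E vtx1) = val21.
Proof.
have L := inner_act_linear (E vtx2) (E vtx1).
rewrite /val21 !(linear_add L, linear_scale L) !inner_act_pure.
by do 2 rewrite -?mulrA ?(mulE dP) /=.
Qed.

Let val12_inner : inner_act (E vtx1) val12 (E vtx2) = val12.
Proof.
have L := inner_act_linear (E vtx1) (E vtx2).
rewrite /val12 !(linear_add L, linear_scale L, linear_opp L) !inner_act_pure.
by do 2 rewrite -?mulrA ?(mulE dP) /=.
Qed.

Let val21_outer : outer_act (E vtx1) val21 (E vtx2) = val21.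
Proof.
rewrite /val21 !outerE !outer_act_pure.
by do 2 rewrite -?mulrA ?(mulE dP) /=.
Qed.

Let val12_outer : outer_act (E vtx2) val12 (E vtx1) = val12.
Proof.
rewrite /val12 !outerE !outer_act_pure.
by do 2 rewrite -?mulrA ?(mulE dP) /=.
Qed.

Let D12 := gen_der 0 val12.
Let D21 := gen_der val21 0.

Let D12P : [/\ outer_base_derivation D12, D12 a = 0 & D12 b = val12].
Proof.
rewrite /D12; have [? -> ->] := gen_derP 0 val12.
by rewrite val12_outer !outerE.
Qed.
Let D21P : [/\ outer_base_derivation D21, D21 a = val21 & D21 b = 0].
Proof.
rewrite /D21; have [? -> ->] := gen_derP val21 0.
by rewrite val21_outer !outerE.
Qed.

(** D12 and D21 are to be {{a,-}} and {{b,-}}; antisymmetry leaves no choice for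
    the values of {{c,-}} at a and b. *)
Definition boalch_br (c : B) : B -> tensor2 B :=
  gen_der (- tau12 (D12 c)) (- tau12 (D21 c)).

Let br_der c : outer_base_derivation (boalch_br c).
Proof. by case: (gen_derP (- tau12 (D12 c)) (- tau12 (D21 c))). Qed.

(* D12 takes its values in the inner corner that v_12 = e_1 v_12 e_2 imposes,
   because it does so at a and b.  Hence the corner projection in the values
   of boalch_br c changes nothing; D21 is treated alike. *)
Let br_a c : boalch_br c a = - tau12 (D12 c).
Proof.
rewrite /boalch_br.
have [_ -> _] := gen_derP (- tau12 (D12 c)) (- tau12 (D21 c)).
have [D12d D12a D12b] := D12P.
rewrite (outer_ext D12d (inner_act_derivation (E vtx1) (E vtx2) D12d)).
- by rewrite /inner_act tau12K !outerE (actA outerP) !(mulE dP).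
- by rewrite D12a (linear_zero (inner_act_linear _ _)).
- by rewrite D12b val12_inner.
Qed.

Let br_b c : boalch_br c b = - tau12 (D21 c).
Proof.
rewrite /boalch_br.
have [_ _ ->] := gen_derP (- tau12 (D12 c)) (- tau12 (D21 c)).
have [D21d D21a D21b] := D21P.
rewrite (outer_ext D21d (inner_act_derivation (E vtx2) (E vtx1) D21d)).
- by rewrite /inner_act tau12K !outerE (actA outerP) !(mulE dP).
- by rewrite D21a val21_inner.
- by rewrite D21b (linear_zero (inner_act_linear _ _)).
Qed.

Let br_a_D12 : boalch_br a =1 D12.
Proof.
have [D12d D12a D12b] := D12P; have [_ D21a _] := D21P.
refine (outer_ext _ _ _ _) => //; first by rewrite br_a D12a linear0 oppr0.
by rewrite br_b D21a D12b tau_val21.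
Qed.

Let br_b_D21 : boalch_br b =1 D21.
Proof.
have [_ _ D12b] := D12P; have [D21d D21a D21b] := D21P.
refine (outer_ext _ _ _ _) => //; first by rewrite br_a D12b D21a tau_val12.
by rewrite br_b D21b linear0 oppr0.
Qed.

Let br_linearl x : linear (boalch_br ^~ x).
Proof.
move=> c u v; move: x; refine (outer_ext _ _ _ _) => //.
- exact: base_derivation_scale_add.
- have [[[DL _] _] _ _] := D12P.
  by rewrite !br_a DL linearP opprD scalerN.
- have [[[DL _] _] _ _] := D21P.
  by rewrite !br_b DL linearP opprD scalerN.
Qed.

Let br_mull c d x : boalch_br (c * d) x =
  inner_act 1 (boalch_br c x) d + inner_act c (boalch_br d x) 1.
Proof.
move: x; refine (outer_ext _ _ _ _) => //.
- have := base_derivation_scale_add 1 (inner_act_derivation 1 d (br_der c))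
    (inner_act_derivation c 1 (br_der d)).
  by under eq_fun do rewrite scale1r.
- have [[[_ DM] _] _ _] := D12P.
  rewrite !br_a DM /inner_act !linearN /= !tau12K !outerE !linearN linearD.
  by rewrite opprD.
- have [[[_ DM] _] _ _] := D21P.
  rewrite !br_b DM /inner_act !linearN /= !tau12K !outerE !linearN linearD.
  by rewrite opprD.
Qed.

Let br_basel i x : boalch_br (E i) x = 0.
Proof.
move: x; refine (outer_ext _ _ _ _) => //.
- split=> //; split=> [c u v|u v]; first by rewrite scaler0 addr0.
  by rewrite !outerE addr0.
- by have [[_ DE] _ _] := D12P; rewrite br_a DE linear0 oppr0.
- by have [[_ DE] _ _] := D21P; rewrite br_b DE linear0 oppr0.
Qed.

Let br_antisym c d : boalch_br c d = - tau12 (boalch_br d c).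
Proof.
move: d; refine (outer_ext _ _ _ _) => //.
- split=> [|i]; last by rewrite br_basel linear0 oppr0.
  split=> [z u v|u v]; first by rewrite br_linearl linearP opprD scalerN.
  by rewrite br_mull linearD /= /inner_act !tau12K !outerE opprD.
- by rewrite br_a br_a_D12.
- by rewrite br_b br_b_D21.
Qed.

Lemma boalch_br_double_bracket : double_bracket E boalch_br.
Proof.
have base (f : B -> tensor2 B) x : linear f -> (forall i, f (E i) = 0) ->
    in_base E x -> f x = 0.
  move=> fL fE [c ->].
  rewrite (big_morph f (linear_add fL) (linear_zero fL)) big1 // => i _.
  by rewrite (linear_scale fL) fE scaler0.
split=> [|c d cB|c d|c d|c u v].
- by split=> c; [exact: br_linearl | have [[]] := br_der c].
- exact: (base (boalch_br ^~ d)).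
- by have [[L _] Z] := br_der c; apply: base.
- exact: br_antisym.
- by have [[_ M] _] := br_der c; apply: M.
Qed.

Lemma boalch_br_values : boalch_bracket_values boalch_br.
Proof.
have [_ D12a D12b] := D12P; have [_ D21a D21b] := D21P.
by split; rewrite ?br_a_D12 ?br_b_D21.
Qed.

End BoalchBracket.

(** * Identities on the generators *)

Section MomentCondition.
Variables (k : fieldType) (A : algType k) (I : finType) (E : I -> A).

(** The right-hand side of the moment map condition, with an arbitrary
    coefficient because e_1 + ab satisfies it with the opposite sign. *)
Definition moment_value (c : k) (i : I) (x z : A) : tensor2 A :=
  c *: (z * E i ⊗ x - E i ⊗ x * z + z * x ⊗ E i - x ⊗ E i * z).

Variable br : A -> A -> tensor2 A.
Hypotheses (eP : idempotent_base E) (brP : double_bracket E br).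

Let br_e x i : br x (E i) = 0.
Proof. exact/(bracket_baser brP)/in_base_base. Qed.

(** The derivation property gives {{z,y}} = - y{{z,x}}y.  In each term of
    {{z,x}} this replaces x by the idempotent and the idempotent by y, which
    exchanges the roles of x and y up to sign. *)
Lemma moment_inverse c i x y :
  y = E i * y * E i -> x * y = E i -> y * x = E i ->
  (forall z, br x z = moment_value c i x z) ->
  forall z, br y z = moment_value (- c) i y z.
Proof.
move=> yP xy yx brx z.
have outerP := outer_act_bimodule A.
have yE : y * E i = y by rewrite (corner_mulr eP _ yP) eqxx.
have Ey : E i * y = y by rewrite (corner_mull eP _ yP) eqxx.
have br_zyx : outer_act 1 (br z y) x = - outer_act y (br z x) 1.
  by apply/eqP; rewrite -addr_eq0 -(bracket_Leibniz brP) yx br_e.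
have br_zy : br z y = - outer_act y (br z x) y.
  rewrite -{1}yE (bracket_Leibniz brP) br_e (act0 outerP) addr0 -xy.
  have -> : outer_act 1 (br z y) (x * y)
      = outer_act 1 (outer_act 1 (br z y) x) y.
    by rewrite (actA outerP) mulr1.
  by rewrite br_zyx (actN outerP) (actA outerP) !mul1r.
have L12 := @tau12_linear k A.
rewrite (bracket_antisym brP) br_zy [br z x](bracket_antisym brP) brx.
rewrite /moment_value !(linear_add L12, linear_scale L12, linear_opp L12).
rewrite !tau12_pure !outerE !outer_act_pure -!mulrA xy Ey !mulrA yE yx.
rewrite !(linear_add L12, linear_scale L12, linear_opp L12, tau12_pure).
lmod k (tensor2 A).
Qed.

End MomentCondition.

Section GeneratorIdentities.
Variables (k : fieldType) (A : algType k).
Variables (E : 'I_2 -> A) (a b h : A).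
Variable br : A -> A -> tensor2 A.
Hypothesis char_neq2 : (2 : k) != 0.
Hypothesis dP : boalch_datum E a b h.
Hypothesis brP : double_bracket E br.
Hypotheses (br_aa : br a a = 0) (br_bb : br b b = 0).
Hypothesis br_ba : br b a =
  E vtx1 ⊗ E vtx2 + 2^-1 *: (a * b ⊗ E vtx2 + E vtx1 ⊗ b * a).
Hypothesis br_ab : br a b =
  - (E vtx2 ⊗ E vtx1) - 2^-1 *: (E vtx2 ⊗ a * b + b * a ⊗ E vtx1).

Let br_e x i : br x (E i) = 0.
Proof. exact/(bracket_baser brP)/in_base_base. Qed.
Let brL := bracket_bilinear brP.
Let bL x := bracketL_linear brP x.
Let L12 := @tau12_linear k A.
Let L123 := @tau123_linear k A.
Let L132 := @tau132_linear k A.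

Let brE := (bracket_Leibniz brP, (fun x => linear_add (brL.2 x)),
  br_e, br_aa, br_bb, br_ab, br_ba,
  @outer_act_pure, @outerE k A, tpureE).
Let tripleE := (fun x => linear_add (bL x), fun x => linear_scale (bL x),
  fun x => linear_opp (bL x), fun x => linear_zero (bL x),
  linear_add L123, linear_scale L123, linear_opp L123, linear_zero L123,
  linear_add L132, linear_scale L132, linear_opp L132, linear_zero L132,
  @tau123_pure k A, @tau132_pure k A,
  fun x y z => @bracketL_pure k A br x y z brL).

Let inv4 : (4 : k)^-1 = 2^-1 * 2^-1.
Proof. by rewrite -invfM -natrM. Qed.

Ltac generator_identity :=
  rewrite /triple_bracket /triple_qP sum_vtx inv4;
  do 6 rewrite -?mulrA ?brE ?tripleE ?(mulE dP) /=; lmod k (tensor3 A).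

Lemma triple_aaa : triple_bracket br a a a = triple_qP E a a a.
Proof. generator_identity. Qed.

Lemma triple_aab : triple_bracket br a a b = triple_qP E a a b.
Proof. generator_identity. Qed.

Lemma triple_abb : triple_bracket br a b b = triple_qP E a b b.
Proof. generator_identity. Qed.

Lemma triple_bbb : triple_bracket br b b b = triple_qP E b b b.
Proof. generator_identity. Qed.

Ltac moment_identity :=
  rewrite (bracket_antisym brP) /moment_value;
  do 6 rewrite -?mulrA ?brE ?(mulE dP) /=;
  rewrite !(linear_add L12, linear_scale L12, linear_opp L12, linear_zero L12,
    tau12_pure);
  lmod k (tensor2 A).

Lemma moment_gamma2_a :
  br (E vtx2 + b * a) a = moment_value E 2^-1 vtx2 (E vtx2 + b * a) a.
Proof. moment_identity. Qed.
Lemma moment_gamma2_b :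
  br (E vtx2 + b * a) b = moment_value E 2^-1 vtx2 (E vtx2 + b * a) b.
Proof. moment_identity. Qed.
Lemma moment_gammaV1_a :
  br (E vtx1 + a * b) a = moment_value E (- 2^-1) vtx1 (E vtx1 + a * b) a.
Proof. moment_identity. Qed.
Lemma moment_gammaV1_b :
  br (E vtx1 + a * b) b = moment_value E (- 2^-1) vtx1 (E vtx1 + a * b) b.
Proof. moment_identity. Qed.

End GeneratorIdentities.

(** * The Hamiltonian structure *)

Section HamiltonianStructure.
Variable k : fieldType.
Hypothesis char_neq2 : (2 : k) != 0.
Local Notation B := (boalch k).
Local Notation E := (@boalch_e k).
Local Notation a := (boalch_v12 k).
Local Notation b := (boalch_v21 k).

(** Cyclic symmetry moves each argument in turn to the last place, where the
    derivation property reduces it to a or b; the four triples represent the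
    cyclic classes of words of length three in a and b. *)
Lemma cyclic_derivation_ext (T Q : B -> B -> B -> tensor3 B) :
  (forall x y, base_derivation (@outer_act3 k B) (T x y)) ->
  (forall x y, base_derivation (@outer_act3 k B) (Q x y)) ->
  (forall x y z, T x y z = tau123 (T y z x)) ->
  (forall x y z, Q x y z = tau123 (Q y z x)) ->
  T a a a = Q a a a -> T a a b = Q a a b ->
  T a b b = Q a b b -> T b b b = Q b b b ->
  forall x y z, T x y z = Q x y z.
Proof.
move=> TP QP Tc Qc aaa aab abb bbb.
have cyc x y z : T y z x = Q y z x -> T x y z = Q x y z.
  by move=> e; rewrite Tc Qc e.
have agree x y : T x y a = Q x y a -> T x y b = Q x y b -> T x y =1 Q x y.
  exact: (base_derivation_ext (outer_act3_bimodule B) (TP x y) (QP x y)).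
have agree_aa y : T y a a = Q y a a by apply/cyc/agree.
have agree_ab y : T y a b = Q y a b.
  by apply/cyc/agree => //; apply/cyc/agree_aa.
have agree_ba y : T y b a = Q y b a by apply/cyc/agree => //; apply/cyc.
have agree_bb y : T y b b = Q y b b by apply/cyc/agree => //; apply/cyc.
by move=> x y; apply: (agree x y); apply/cyc/agree.
Qed.

Variable br : B -> B -> tensor2 B.
Hypotheses (brP : double_bracket E br) (brV : boalch_bracket_values br).
Let dP := boalch_datumP k.

Lemma boalch_quasi_Poisson : quasi_Poisson E br.
Proof.
have [aa bb ba ab] := brV.
apply: cyclic_derivation_ext.
- move=> x y; split; first exact: (triple_bracket_derivation brP).
  exact: (triple_bracket_base brP).
- move=> x y; split; first exact: triple_qP_derivation.
  exact/triple_qP_base/boalch_base.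
- exact: triple_bracket_cyclic.
- exact: triple_qP_cyclic.
- by apply: (triple_aaa dP brP).
- by apply: (triple_aab dP brP).
- by apply: (triple_abb dP brP).
- by apply: (triple_bbb dP brP).
Qed.

(** The commutator with c (e_i ⊗ x + x ⊗ e_i), an element with which the
    idempotents commute. *)
Lemma moment_value_derivation c i (x : B) : x = E i * x * E i ->
  base_derivation (@outer_act k B) (moment_value E c i x).
Proof.
move=> xP; have eP := boalch_base k.
pose m : tensor2 B := c *: (E i ⊗ x + x ⊗ E i).
have innerE : moment_value E c i x
    = (fun z => outer_act z m 1 - outer_act 1 m z).
  apply: funext => z; rewrite /m /moment_value !outerE !outer_act_pure.
  by rewrite !mul1r !mulr1 -scalerBr opprD addrACA addrA.
split; first by rewrite innerE; apply/inner_derivation/outer_act_bimodule.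
move=> j; rewrite /moment_value !(base_orthogonal eP).
rewrite (corner_mull eP _ xP) (corner_mulr eP _ xP) [j == i]eq_sym.
case: eqP => [->|_]; first by rewrite subrr add0r subrr scaler0.
by rewrite !(tpure0l, tpure0r) subrr addr0 subr0 scaler0.
Qed.

Lemma moment_ext c i (x : B) : x = E i * x * E i ->
  br x a = moment_value E c i x a -> br x b = moment_value E c i x b ->
  forall z, br x z = moment_value E c i x z.
Proof.
move=> xP; apply: (base_derivation_ext (outer_act_bimodule B)).
  exact: double_bracket_base_derivation.
exact: moment_value_derivation.
Qed.

Lemma boalch_moment_map : multiplicative_moment_map E br (boalch_Phi k).
Proof.
have [aa bb ba ab] := brV; have eP := boalch_base k.
pose g i : B := boalch_gamma k i; pose gV i : B := pgen _ (GgammaV i).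
have gP i : g i = E i * g i * E i := boalch_relE (br_gamma k i).
have gVP i : gV i = E i * gV i * E i := boalch_relE (br_gammaV k i).
have gK i : g i * gV i = E i := boalch_relE (br_gammaK k i).
have gVK i : gV i * g i = E i := boalch_relE (br_gammaVK k i).
split.
  exists (gV vtx1 + gV vtx2).
  rewrite (base_sum2 eP) /boalch_Phi -/(g _) -/(g _) !mulrDl !mulrDr.
  rewrite (corner_mul0 eP (gP vtx1) (gVP vtx2)) //.
  rewrite (corner_mul0 eP (gP vtx2) (gVP vtx1)) //.
  rewrite (corner_mul0 eP (gVP vtx1) (gP vtx2)) //.
  rewrite (corner_mul0 eP (gVP vtx2) (gP vtx1)) // !addr0 !add0r.
  by rewrite !gK !gVK.
exists (@boalch_gamma k); split=> [i||i z].
- by exists (boalch_gamma k i); apply: gP.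
- by rewrite sum_vtx.
have [->|->] := vtxP i.
- rewrite -[2^-1]opprK; apply: (moment_inverse eP brP (gP vtx1) (gVK vtx1)
    (gK vtx1)); apply: (moment_ext (gVP vtx1)); rewrite /gV boalch_gammaV1E.
    by apply: (moment_gammaV1_a char_neq2 dP brP).
  by apply: (moment_gammaV1_b char_neq2 dP brP).
- apply: (moment_ext (gP vtx2)); rewrite /g boalch_gamma2E.
    by apply: (moment_gamma2_a char_neq2 dP brP).
  by apply: (moment_gamma2_b char_neq2 dP brP).
Qed.

End HamiltonianStructure.

Theorem proposition4p1 (k : fieldType) (char0 : [pchar k] =i pred0) :
  exists br : boalch k -> boalch k -> tensor2 (boalch k),
    [/\ double_bracket (@boalch_e k) br /\ boalch_bracket_values br,
        (forall br' : boalch k -> boalch k -> tensor2 (boalch k),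
           double_bracket (@boalch_e k) br' -> boalch_bracket_values br' ->
           forall a b, br' a b = br a b) &
        Hamiltonian_double_quasi_Poisson (@boalch_e k) br (boalch_Phi k)].
Proof.
have neq2 : (2 : k) != 0.
  by apply/negP => two0; have := char0 2%N; rewrite !inE two0.
have brP := boalch_br_double_bracket k; have brV := boalch_br_values k.
exists (@boalch_br k); split.
- by [].
- move=> br' br'P [aa' bb' ba' ab'] x y; have [aa bb ba ab] := brV.
  by apply: double_bracket_ext; rewrite ?aa ?bb ?ba ?ab.
- split=> //; first exact: boalch_base.
    exact: boalch_quasi_Poisson.
  exact: boalch_moment_map.
Qed.
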